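(* Let $F$ be Richard Thompson's group, i.e. the group given by the presentation $\langle x_0,x_1,x_2,\ldots\mid x_j^{x_i}=x_{j+1}\ (i<j)\rangle$. The isodiametric function of $F$ is linear.
   Context: Notation: $a^b=b^{-1}ab$. The group $F$ is finitely presented; namely it is given by $\langle x_0,x_1\mid x_2^{x_1}=x_3,\ x_3^{x_1}=x_4\rangle$, where $x_{k+1}$ denotes $x_1^{x_0^k}$ for all $k\ge1$. The diameter of a van Kampen diagram is the diameter of its underlying graph, i.e. the greatest distance between its points. The isodiametric function of a finite group presentation is the smallest function $d(n)$ such that for any word $w$ of length $\le n$ that is equal to $1$ in the group, there is a van Kampen diagram over the presentation of diameter $\le d(n)$ with boundary label $w$. For functions $p,q:\mathbf N\to\mathbf N$, write $p\preceq q$ if there is a positive integer constant $C$ such that $p(n)\le Cq(Cn)+Cn$ for all $n$; write $p\sim q$ if $p\preceq q$ and $q\preceq p$. Isodiametric functions of different finite presentations of the same group are equivalent under $\sim$, and the isodiametric function of a finitely presented group is that of any of its finite presentations, considered modulo $\sim$. Linear means $\sim n$. *)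

(* Defs.v *)
(* Classical logic (boolp) is used only to decide equality in the group given by
   a presentation. *)
From HB Require Import structures.
From mathcomp Require Import all_boot.
From mathcomp Require Import boolp.

Set Implicit Arguments.
Unset Strict Implicit.
Unset Printing Implicit Defensive.

Local Open Scope quotient_scope.

(** * Words and groups given by presentations *)

(* [(x, false)] is the generator [x], and [(x, true)] is its formal inverse. *)
Notation letter X := (X * bool)%type.
Notation word X := (seq (letter X)).

Definition inv_letter (X : Type) (a : letter X) : letter X := (a.1, ~~ a.2).
Definition inv_word (X : Type) (w : word X) : word X := rev (map (@inv_letter X) w).
Definition gen_word (X : Type) (x : X) : word X := [:: (x, false)].
Definition conj_word (X : Type) (a b : word X) : word X := inv_word b ++ a ++ b.

(* A presentation with generators [X] is given by its set of relators, an
   equation [u = v] being encoded by the relator [u v^-1]. *)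
Inductive pres_eq (X : Type) (R : word X -> Prop) : word X -> word X -> Prop :=
| pres_refl u : pres_eq R u u
| pres_sym u v : pres_eq R u v -> pres_eq R v u
| pres_trans v u w : pres_eq R u v -> pres_eq R v w -> pres_eq R u w
| pres_cancel u a v : pres_eq R (u ++ [:: a; inv_letter a] ++ v) (u ++ v)
| pres_relator u r v : R r -> pres_eq R (u ++ r ++ v) (u ++ v).

Lemma inv_letterK (X : Type) : involutive (@inv_letter X).
Proof. by case=> x b; rewrite /inv_letter /= negbK. Qed.

Lemma inv_wordK (X : Type) : involutive (@inv_word X).
Proof.
move=> w; rewrite /inv_word map_rev revK -map_comp -[RHS]map_id.
by apply: eq_map => a; apply: inv_letterK.
Qed.

Lemma inv_word_cat (X : Type) (u v : word X) :
  inv_word (u ++ v) = inv_word v ++ inv_word u.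
Proof. by rewrite /inv_word map_cat rev_cat. Qed.

Section PresentedGroup.
Variables (X : choiceType) (R : word X -> Prop).
Implicit Types u v w : word X.

Lemma pres_ctx a b u v : pres_eq R u v -> pres_eq R (a ++ u ++ b) (a ++ v ++ b).
Proof.
elim=> {u v} [u|u v _|v u w _ IH1 _ IH2|u c v|u r v Rr].
- exact: pres_refl.
- exact: pres_sym.
- exact: pres_trans IH1 IH2.
- by have := pres_cancel R (a ++ u) c (v ++ b); rewrite -!catA.
- by have := pres_relator (a ++ u) (v ++ b) Rr; rewrite -!catA.
Qed.

Lemma pres_cat u u' v v' :
  pres_eq R u u' -> pres_eq R v v' -> pres_eq R (u ++ v) (u' ++ v').
Proof.
move=> /(pres_ctx [::] v) Hu /(pres_ctx u' [::]).
by rewrite !cats0; apply: pres_trans Hu.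
Qed.

Lemma pres_mulV u : pres_eq R (u ++ inv_word u) [::].
Proof.
elim/last_ind: u => [|u a IH]; first exact: pres_refl.
apply: pres_trans IH; have := pres_cancel R u a (inv_word u).
by rewrite -cats1 inv_word_cat -!catA.
Qed.

Lemma pres_Vmul u : pres_eq R (inv_word u ++ u) [::].
Proof. by rewrite -{2}[u]inv_wordK; apply: pres_mulV. Qed.

Lemma pres_inv u v : pres_eq R u v -> pres_eq R (inv_word u) (inv_word v).
Proof.
move=> /pres_sym uv.
have := pres_ctx (inv_word u) (inv_word v) uv.
have := pres_ctx (inv_word u) [::] (pres_mulV v); rewrite !cats0 => vV.
have := pres_ctx [::] (inv_word v) (pres_Vmul u); rewrite /= -catA => Vu.
by move=> H; apply: pres_trans (pres_sym vV) _; apply: pres_trans H Vu.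
Qed.

Definition pres_rel : rel (word X) := fun u v => `[< pres_eq R u v >].

Lemma pres_rel_equiv : equiv_class_of pres_rel.
Proof.
split=> [u|u v|v u w].
- exact/asboolP/pres_refl.
- by apply/asboolP/asboolP => /pres_sym.
- by move=> /asboolP uv /asboolP vw; apply/asboolP; apply: pres_trans vw.
Qed.

Canonical pres_equiv := EquivRelPack pres_rel_equiv.

Definition pres_group : Type := {eq_quot pres_equiv}.
HB.instance Definition _ := Choice.on pres_group.
HB.instance Definition _ := EqQuotient.on pres_group.

Definition val_word (w : word X) : pres_group := \pi_pres_group w.

Lemma val_wordP u v : val_word u = val_word v <-> pres_eq R u v.
Proof.
split=> [/eqquotP/asboolP //|uv].
by apply/eqquotP/asboolP.
Qed.

Lemma val_word_repr (g : pres_group) : val_word (repr g) = g.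
Proof. exact: reprK. Qed.

Lemma repr_val_word w : pres_eq R (repr (val_word w)) w.
Proof. by apply/val_wordP; rewrite val_word_repr. Qed.

Definition pg_one : pres_group := val_word [::].
Definition pg_mul (g h : pres_group) : pres_group := val_word (repr g ++ repr h).
Definition pg_inv (g : pres_group) : pres_group := val_word (inv_word (repr g)).

Lemma pg_mulE u v : pg_mul (val_word u) (val_word v) = val_word (u ++ v).
Proof. by apply/val_wordP/pres_cat; apply: repr_val_word. Qed.

Lemma pg_invE u : pg_inv (val_word u) = val_word (inv_word u).
Proof. by apply/val_wordP/pres_inv/repr_val_word. Qed.

Lemma pg_mulA : associative pg_mul.
Proof.
move=> f g h; rewrite -(val_word_repr f) -(val_word_repr g) -(val_word_repr h).
by rewrite !pg_mulE catA.
Qed.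

Lemma pg_mul1 : left_id pg_one pg_mul.
Proof. by move=> g; rewrite -(val_word_repr g) pg_mulE. Qed.

Lemma pg_mulr1 : right_id pg_one pg_mul.
Proof. by move=> g; rewrite -(val_word_repr g) pg_mulE cats0. Qed.

Lemma pg_mulV : left_inverse pg_one pg_inv pg_mul.
Proof.
by move=> g; rewrite -(val_word_repr g) pg_invE pg_mulE; apply/val_wordP/pres_Vmul.
Qed.

Lemma pg_mulrV : right_inverse pg_one pg_inv pg_mul.
Proof.
by move=> g; rewrite -(val_word_repr g) pg_invE pg_mulE; apply/val_wordP/pres_mulV.
Qed.

HB.instance Definition _ :=
  isGroup.Build pres_group pg_mulA pg_mul1 pg_mulr1 pg_mulV pg_mulrV.

End PresentedGroup.

Arguments val_word {X} R w.

Definition isomorphic (G H : groupType) : Prop :=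
  exists f : {multiplicative G -> H}, bijective f.

Definition fin_rel (X : eqType) (R : seq (word X)) : word X -> Prop :=
  fun r => r \in R.

(* The group [< X | R >] for a finite presentation. *)
Definition fin_pres_group (X : finType) (R : seq (word X)) : groupType :=
  pres_group (fin_rel R).

Definition finite_presentation_of (G : groupType) (X : finType)
    (R : seq (word X)) : Prop :=
  isomorphic G (fin_pres_group R).

Definition finitely_presented (G : groupType) : Prop :=
  exists (X : finType) (R : seq (word X)), finite_presentation_of G R.

(* The relators [x_j ^ x_i = x_(j+1)], for [i < j]. *)
Definition thompson_rel (r : word nat) : Prop :=
  exists i j : nat, i < j /\
    r = conj_word (gen_word j) (gen_word i) ++ inv_word (gen_word j.+1).

Definition thompson_F : groupType := pres_group thompson_rel.

(** * Van Kampen diagrams *)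

(* Graphs in the sense of Serre: a geometric edge is a pair of mutually reverse
   darts, so loops and multiple edges are allowed. *)
Definition adjacent (V D : finType) (org : D -> V) (opp : D -> D) : rel V :=
  fun u v => [exists d, (org d == u) && (org (opp d) == v)].

Record connected_graph : Type := ConnectedGraph {
  vertex : finType;
  dart : finType;
  origin : dart -> vertex;
  opp : dart -> dart;
  oppK : involutive opp;
  opp_neq : forall d, opp d != d;
  graph_connected : forall u v, connect (adjacent origin opp) u v
}.

Section Distance.
Variable G : connected_graph.

Definition has_walk (u v : vertex G) (k : nat) : bool :=
  [exists p : k.-tuple (vertex G),
     path (adjacent (@origin G) (@opp G)) u p && (last u p == v)].

Lemma has_walk_ex (u v : vertex G) : exists k, has_walk u v k.
Proof.
have /connectP[p pP ->] := graph_connected u v.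
by exists (size p); apply/existsP; exists (in_tuple p); rewrite /= pP eqxx.
Qed.

Definition distance (u v : vertex G) : nat := ex_minn (has_walk_ex u v).

Definition diameter : nat :=
  \max_(u : vertex G) \max_(v : vertex G) distance u v.

End Distance.

Section Diagram.
Variables (X : eqType) (R : seq (word X)).

Definition cell_label (u : word X) : Prop :=
  exists r k, r \in R /\ (u = rot k r \/ u = rot k (inv_word r)).

(* A finite connected graph drawn in the plane is encoded by its rotation
   system: [turn] permutes cyclically the darts issued from each vertex, and the
   boundary walks of the faces are the cycles of [face_next]. The duplicate-free
   cycle [outer] is the boundary walk of the unbounded face, read from a base
   point; it is empty only for the diagram consisting of a single vertex. The
   other cycles of [face_next] are the boundaries of the cells, and the rotation
   system is planar iff the Euler characteristic #vertices - #edges + #cells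
   (without the unbounded face) is 1. All faces are traversed on the same side of
   their darts, so inner and outer boundaries have opposite orientations; this is
   harmless since [cell_label] is closed under inversion. *)
Record diagram (w : word X) : Type := Diagram {
  skeleton :> connected_graph;
  label : dart skeleton -> letter X;
  label_opp : forall d, label (opp d) = inv_letter (label d);
  turn : dart skeleton -> dart skeleton;
  turn_inj : injective turn;
  turn_orbit : forall d e, fconnect turn d e = (origin d == origin e);
  face_next : dart skeleton -> dart skeleton := fun d => turn (opp d);
  outer : seq (dart skeleton);
  outer_uniq : uniq outer;
  outer_cycle : fcycle face_next outer;
  outer_nil : outer = [::] -> #|dart skeleton| = 0;
  outer_label : map label outer = w;
  cells : forall d, d \notin outer -> cell_label (map label (orbit face_next d));
  euler : #|vertex skeleton| + fcard face_next [predC outer]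
          = #|dart skeleton|./2 + 1
}.

End Diagram.

(** * Isodiametric functions *)

Definition isodiametric_bound (X : finType) (R : seq (word X))
    (d : nat -> nat) : Prop :=
  forall (n : nat) (w : word X), size w <= n ->
    val_word (fin_rel R) w = 1%g ->
    exists D : diagram R w, diameter D <= d n.

Definition isodiametric_function (X : finType) (R : seq (word X))
    (d : nat -> nat) : Prop :=
  isodiametric_bound R d /\
  forall d', isodiametric_bound R d' -> forall n, d n <= d' n.

Definition preceq (p q : nat -> nat) : Prop :=
  exists C : nat, 0 < C /\ forall n, p n <= C * q (C * n) + C * n.

Definition equivalent (p q : nat -> nat) : Prop := preceq p q /\ preceq q p.

Definition linear (p : nat -> nat) : Prop := equivalent p (fun n => n).

(* Main.v *)
(* Write each null word w of length n in the generators of F as a product of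
   conjugates p r p^-1 of relators with |p| = O(n).  To this end, comb w: moving
   its letters one at a time into a normal form P Q^-1, with P and Q sorted
   products of the x_i with O(n) letters and indices in O(n), uses relations
   x_j x_i = x_i x_(j+1) which have fillings of linear radius, and takes place
   after prefixes that are equal in the free group to words of length O(n),
   because x_0-conjugations telescope along a sorted product.  Sorted products
   are distinguished by the action of F on the line, so w = 1 forces P = Q.

   Conversely such a product gives a diagram of diameter O(n): start with a tree
   of lollipops, cut off the cells, and fold the boundary word down to w.  Planar
   maps are pairs of permutations, folding multiplies one of them by a
   transposition, and nonnegativity of the genus shows that a fold which would
   pinch the map detaches a sphere, which is discarded; distances to the base
   point do not increase. *)
Require Import Defs.
From HB Require Import structures.
From mathcomp Require Import all_boot fingroup perm.
From mathcomp Require Import boolp.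
From mathcomp Require order ssralg ssrnum ssrint rat lra.
From mathcomp Require Import zify.

Set Implicit Arguments.
Unset Strict Implicit.
Unset Printing Implicit Defensive.

Local Open Scope group_scope.

(** * Genus of a pair of permutations *)

(** Only the lengths of the conjugators matter, never their number, so a chain of rewritings costs
    the maximum of its radii and not their sum. What has to be controlled is the free-group length
    of the prefix to the left of each rewriting; a context on the right is free. A generator x_i has
    length about 2i, so n of them with indices near n could need length n^2: sortedness is what
    makes the powers of x_0 cancel. An arbitrary finite presentation is treated inside its own free
    group, where x_0 and x_1 are lifted to two fixed elements. On the geometric side w need not be
    freely reduced, so folding a product of conjugates could not recover it. The tree therefore also
    contains a path with contour w w^-1, and w^-1 is folded against the conjugates. A free
    cancellation is treated as cutting off a digon; digons are closed up at the end. *)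

Section Planarity.
Variable T : finType.
Implicit Types (e : rel T) (s t : {perm T}) (x y u v : T).

(** Inside the closure of [x] and [y] one component remains, outside it nothing changes; the loops
    that [tperm x y] has at other points are harmless. *)
Lemma n_comp_add_tperm e x y : connect_sym e ->
  n_comp e T = n_comp (relU e (frel (tperm x y))) T + ~~ connect e x y.
Proof.
move=> sym_e; set e' := relU _ _.
have sym_e' : connect_sym e'.
  by apply: relU_sym => //; apply: fconnect_sym; apply: perm_inj.
have ee' u v : connect e u v -> connect e' u v.
  by apply: connect_sub => {u v} u v uv; rewrite connect1 //= uv.
pose a := closure e (pred2 x y).
have cl_a : closed e a by apply: closure_closed.
have ax : x \in a by rewrite mem_closure // inE eqxx.
have ay : y \in a by rewrite mem_closure // inE eqxx orbT.
have cl_a' : closed e' a.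
  move=> u v /orP[/cl_a //|/eqP<-].
  by case: tpermP => [->|->|] //; rewrite ax ay.
have e'xy : connect e' x y by rewrite connect1 //= tpermL eqxx orbT.
have a'E : a =i connect e' x.
  move=> u; apply/idP/idP => [/pred0Pn[v /andP[/ee' uv vxy]]|xu].
    rewrite inE sym_e'; apply: connect_trans uv _.
    by case/pred2P: vxy => -> //; rewrite sym_e'.
  by rewrite -(closed_connect cl_a' xu).
have n_a : n_comp e a = n_comp e' a + ~~ connect e x y.
  rewrite n_comp_closure2 // (eq_n_comp_r (e := e') a'E).
  by rewrite (n_comp_connect sym_e') -add1n.
have n_ca : n_comp e [predC a] = n_comp e' [predC a].
  have pE u : u \in [predC a] -> connect e u =1 connect e' u.
    move=> ua v; apply/idP/idP; first exact: ee'.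
    case/connectP=> p e_p ->; elim: p u ua e_p => //= w p IHp u ua.
    case/andP=> uw e_p; have wa : w \in [predC a].
      by have := cl_a' _ _ uw; rewrite !inE in ua * => <-.
    apply: connect_trans (IHp w wa e_p); case/orP: uw => [/connect1 //|].
    have [ux uy] : u != x /\ u != y.
      by split; apply: contraNneq ua => ->.
    by rewrite /= tpermD 1?eq_sym // => /eqP->.
  apply: eq_card => u; rewrite !inE /=; case ua: (u \in a); first by rewrite !andbF.
  by rewrite !andbT /roots /root (eq_pick (pE u _)) // inE ua.
by rewrite (n_compC a) (n_compC a e') n_a n_ca addnAC.
Qed.

Definition conn s t : rel T := relU (frel s) (frel t).

Lemma conn_sym s t : connect_sym (conn s t).
Proof. by apply: relU_sym; apply: fconnect_sym; apply: perm_inj. Qed.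

Lemma connect_perml s t x : connect (conn s t) x (s x).
Proof. by apply: connect1; rewrite /conn /= eqxx. Qed.

Lemma connect_permr s t x : connect (conn s t) x (t x).
Proof. by apply: connect1; rewrite /conn /= eqxx orbT. Qed.

Lemma connect_permM s t x : connect (conn s t) x ((s * t) x).
Proof.
by rewrite permM; apply: connect_trans (connect_perml _ _ _) (connect_permr _ _ _).
Qed.

Lemma fconnect_conn s t (r : T -> T) : (forall x, connect (conn s t) x (r x)) ->
  forall x y, fconnect r x y -> connect (conn s t) x y.
Proof. by move=> H x y; apply: connect_sub => {x y} x _ /eqP <-. Qed.

Definition comps s t := n_comp (conn s t) T.
Definition cycles s := fcard s T.

Lemma mem_porbit_fconnect s x y : (y \in porbit s x) = fconnect s x y.
Proof.
apply/porbitP/idP => [[i ->]|/iter_findex <-].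
  by rewrite permX fconnect_iter.
by exists (findex s x y); rewrite permX.
Qed.

Lemma cyclesE s : cycles s = #|porbits s|.
Proof.
have sym := @fconnect_sym _ _ (@perm_inj _ s).
rewrite /cycles /n_comp_mem.
have inj : {in predI (froots s) T &, injective (porbit s)}.
  move=> x y /andP[/eqP rx _] /andP[/eqP ry _] /eqP.
  by rewrite eq_porbit_mem mem_porbit_fconnect sym => /(rootP sym); rewrite rx ry.
rewrite -(card_in_imset inj); apply: eq_card => A.
apply/imsetP/imsetP => [[x _ ->]|[x _ ->]]; first by exists x.
exists (froot s x); first by rewrite inE (roots_root sym).
apply/eqP; rewrite eq_porbit_mem mem_porbit_fconnect sym.
exact: connect_root.
Qed.

Lemma cycles_mulr_tperm s x y : x != y ->
  cycles (s * tperm x y) + (~~ fconnect s x y).*2 = (cycles s).+1.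
Proof.
(* Inversion keeps the cycles and turns the right factor into a left one. *)
move=> xy; have /= := porbits_mul_tperm s^-1 x y.
rewrite -[(tperm x y * _)]invgK invMg invgK tpermV !porbitsV porbitV -!cyclesE.
by rewrite mem_porbit_fconnect fconnect_sym ?xy ?addn1 //; apply: perm_inj.
Qed.

Lemma cycles_conj s t : cycles (s ^ t) = cycles s.
Proof.
rewrite /cycles; symmetry.
have sym r := @fconnect_sym _ _ (@perm_inj T r).
rewrite (@adjunction_n_comp _ _ t^-1 _ (frel (s ^ t))) //.
apply: strict_adjunction => //.
- exact: perm_inj.
- by apply/subsetP => x _; apply/codomP; exists (t x); rewrite permK.
- move=> x y _ /=; rewrite /conjg !permM -[in RHS](inj_eq (@perm_inj _ t^-1)).
  by rewrite permK.
Qed.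

Lemma connect_mulr_tperm s t x y :
  connect (relU (conn s t) (frel (tperm x y))) =2
  connect (relU (conn s (t * tperm x y)) (frel (tperm x y))).
Proof.
have sub t1 t2 : (forall u, t1 u = t2 u \/ t1 u = tperm x y (t2 u)) ->
    subrel (connect (relU (conn s t1) (frel (tperm x y))))
           (connect (relU (conn s t2) (frel (tperm x y)))).
  move=> H; apply: connect_sub => u v /orP[/orP[/eqP<-|/eqP<-]|/eqP<-].
  - by apply: connect1; rewrite /conn /= eqxx.
  - case: (H u) => ->; first by apply: connect1; rewrite /conn /= eqxx orbT.
    by apply: (@connect_trans _ _ (t2 u)); apply: connect1; rewrite /conn /= eqxx ?orbT.
  - by apply: connect1; rewrite /= eqxx orbT.
move=> u v; apply/idP/idP; apply: sub => w; right; rewrite permM ?tpermK //.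
Qed.

(** Once [x] and [y] are linked, [t] and [t * tperm x y] have the same components; each count
    exceeds this common value by 1 exactly when [x] and [y] are not yet connected. *)
Lemma comps_mulr_tperm s t x y :
  comps s (t * tperm x y) + ~~ connect (conn s t) x y =
  comps s t + ~~ connect (conn s (t * tperm x y)) x y.
Proof.
rewrite /comps !(n_comp_add_tperm x y (conn_sym _ _)).
by rewrite (eq_n_comp (@connect_mulr_tperm s t x y)) addnAC.
Qed.

Lemma comps1 t : comps 1 t = cycles t.
Proof.
apply: eq_n_comp => u v; apply/idP/idP; apply: connect_sub => {u v} u v.
  by case/orP=> [/eqP<-|/connect1 //]; rewrite perm1 connect0.
by move=> uv; apply: connect1; apply/orP; right.
Qed.

Lemma compsC s t : comps s t = comps t s.
Proof. by apply: eq_n_comp; apply: eq_connect => u v; rewrite /conn /= orbC. Qed.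

Lemma cycles1 : cycles 1 = #|T|.
Proof.
rewrite /cycles -[RHS](fcard_id T); apply: eq_n_comp; apply: eq_connect => u v.
by rewrite /= perm1.
Qed.

(* The genus of a hypermap is nonnegative: writing [t] as a product of
   transpositions, each factor that lowers the number of components lowers the
   number of cycles of [s * t], and every other one changes it by one. *)
Lemma ree s t : cycles s + cycles t + cycles (s * t) <= #|T| + (comps s t).*2.
Proof.
have [n] := ubnP #|[set x | t x != x]|; elim: n t => // n IHn t le_n.
case: (posnP #|[set x | t x != x]|) => [fix_t|/card_gt0P[x tx]].
  have ->: t = 1.
    apply/permP => x; rewrite perm1; apply/eqP/negbNE; rewrite -(in_set (fun x => t x != x)).
    by rewrite (card0_eq fix_t).
  by rewrite mulg1 compsC comps1 cycles1; lia.
rewrite inE in tx; pose y := t x; pose t' := t * tperm x y.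
have xy : x != y by rewrite eq_sym.
have t'x : t' x = x by rewrite permM tpermR.
have lt_n : #|[set x | t' x != x]| < n.
  rewrite ltnS in le_n; apply: leq_trans le_n.
  apply: proper_card; apply/properP; split; last first.
    by exists x; rewrite !inE ?tx // t'x eqxx.
  apply/subsetP => u; rewrite !inE permM; apply: contra => /eqP tu.
  rewrite tu; case: tpermP => // [ux|uy]; first by rewrite -ux tu eqxx in tx.
  by rewrite uy in tu; move/perm_inj: tu => yx; rewrite yx eqxx in xy.
have := IHn t' lt_n.
have := cycles_mulr_tperm t xy; rewrite -/t'.
have -> : fconnect t x y by apply: fconnect1.
have := cycles_mulr_tperm (s * t) xy; rewrite -mulgA -/t'.
have := comps_mulr_tperm s t x y; rewrite -/t'.
have -> : connect (conn s t) x y by apply: connect_permr.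
have : fconnect (s * t') x y -> connect (conn s t') x y.
  by apply: fconnect_conn => u; apply: connect_permM.
have := cycles_mulr_tperm (s * t') xy.
have -> : s * t' * tperm x y = s * t by rewrite /t' -!mulgA tperm2 mulg1.
case: (fconnect (s * t') x y); case: (connect (conn s t') x y);
  case: (fconnect (s * t) x y) => //=; lia.
Qed.

(** The converse of [ree], that is, genus 0, with edges [s], faces [t] and vertices [s * t]. *)
Definition planar s t := #|T| + (comps s t).*2 <= cycles s + cycles t + cycles (s * t).

(** In the excluded case [x] and [y] lie in one component but in different faces and at different
    vertices; merging both pairs would add a handle. *)
Lemma planar_mulr_tperm s t x y : x != y -> planar s t ->
  fconnect t x y || fconnect (s * t) x y || ~~ connect (conn s t) x y ->
  planar s (t * tperm x y).
Proof.
rewrite /planar => xy pl; pose t' := t * tperm x y; rewrite -/t'.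
have := cycles_mulr_tperm t xy; rewrite -/t'.
have := cycles_mulr_tperm (s * t) xy; rewrite -mulgA -/t'.
have := comps_mulr_tperm s t x y; rewrite -/t'.
have : fconnect t x y -> connect (conn s t) x y.
  by apply: fconnect_conn => u; apply: connect_permr.
have : fconnect (s * t) x y -> connect (conn s t) x y.
  by apply: fconnect_conn => u; apply: connect_permM.
have : fconnect (s * t') x y -> connect (conn s t') x y.
  by apply: fconnect_conn => u; apply: connect_permM.
have : fconnect t' x y -> connect (conn s t') x y.
  by apply: fconnect_conn => u; apply: connect_permr.
have := cycles_mulr_tperm (s * t') xy.
have := cycles_mulr_tperm t' xy.
have -> : t' * tperm x y = t by rewrite /t' -!mulgA tperm2 mulg1.
have -> : s * t' * tperm x y = s * t by rewrite /t' -!mulgA tperm2 mulg1.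
move: pl; move: (cycles s) (cycles t) (cycles t') (cycles (s * t)) (cycles (s * t')).
move: (comps s t) (comps s t') #|T| => c c' n zs zt zt' zst zst'.
case: (fconnect (s * t') x y); case: (connect (conn s t') x y);
case: (fconnect t' x y); case: (connect (conn s t) x y); 
case: (fconnect (s * t) x y); case: (fconnect t x y) => //=; lia.
Qed.

(** A face and a vertex split together, which raises the number of cycles by 2. With no new
    component, [ree] would fail for the new pair. *)
Lemma planar_split_disconnected s t x y : x != y -> planar s t ->
  fconnect t x y -> fconnect (s * t) x y ->
  ~~ connect (conn s (t * tperm x y)) x y.
Proof.
rewrite /planar => xy pl txy stxy; pose t' := t * tperm x y; rewrite -/t'.
apply/negP => cxy; have := ree s t'; move: pl.
have := cycles_mulr_tperm t xy; rewrite txy -/t'.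
have := cycles_mulr_tperm (s * t) xy; rewrite stxy -mulgA -/t'.
have := comps_mulr_tperm s t x y; rewrite cxy -/t'.
have -> : connect (conn s t) x y.
  by apply: fconnect_conn txy => u; apply: connect_permr.
move: (cycles s) (cycles t) (cycles t') (cycles (s * t)) (cycles (s * t')).
move: (comps s t) (comps s t') #|T| => /=; lia.
Qed.

Lemma planarC s t : planar s t = planar t s.
Proof.
rewrite /planar compsC (addnC (cycles s)).
have -> : s * t = (t * s) ^ t by rewrite /conjg !mulgA mulVg mul1g.
by rewrite cycles_conj.
Qed.

End Planarity.

(** * Cutting off a face *)

Section Cycles.
Variable T : finType.
Implicit Types (s t : {perm T}) (x y d : T) (o u v : seq T).

Lemma fconnect_mulr_tperm t x y : x != y ->
  fconnect (t * tperm x y) x y = ~~ fconnect t x y.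
Proof.
move=> xy; have := cycles_mulr_tperm t xy.
have := cycles_mulr_tperm (t * tperm x y) xy; rewrite -mulgA tperm2 mulg1.
by case: (fconnect _ x y); case: (fconnect _ x y) => //=; lia.
Qed.

Lemma fpath_mulr_tperm t x y a u : x \notin u -> y \notin u ->
  fpath (t * tperm x y) a u = fpath t a u.
Proof.
elim: u a => //= b u IHu a; rewrite !inE !negb_or => /andP[xb xu] /andP[yb yu].
by rewrite IHu // permM -[in RHS](inj_eq (@perm_inj _ (tperm x y))) (tpermD xb yb).
Qed.

Lemma fcycle_split t x y u v : uniq (x :: u ++ y :: v) ->
  fcycle t (x :: u ++ y :: v) ->
  fcycle (t * tperm x y) (x :: u) /\ fcycle (t * tperm x y) (y :: v).
Proof.
rewrite /= mem_cat inE !negb_or cat_uniq /= negb_or.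
case/and5P=> /and3P[xu xy xv] Uu /andP[yu _] yv Uv.
rewrite rcons_cat cat_path /= rcons_path => /and4P[pu /eqP tu pv /eqP tv].
rewrite !rcons_path !fpath_mulr_tperm // pu pv /= !permM tu tv.
by rewrite tpermL tpermR !eqxx.
Qed.

Lemma fcycle_join t x y u v : uniq (x :: u ++ y :: v) ->
  fcycle t (x :: u) -> fcycle t (y :: v) ->
  fcycle (t * tperm x y) (x :: u ++ y :: v).
Proof.
rewrite /= mem_cat inE !negb_or cat_uniq /= negb_or.
case/and5P=> /and3P[xu xy xv] Uu /andP[yu _] yv Uv.
rewrite rcons_cat cat_path /= !rcons_path => /andP[ptu /eqP tx] /andP[ptv /eqP ty].
by rewrite !fpath_mulr_tperm // ptu ptv /= !permM tx ty tpermL tpermR !eqxx.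
Qed.

Lemma fcycle_mulr_tperm t x y o : x \notin o -> y \notin o ->
  fcycle t o -> fcycle (t * tperm x y) o.
Proof.
by case: o => //= a o xo yo; rewrite fpath_mulr_tperm ?mem_rcons.
Qed.

Lemma fcycle_fconnect t o : fcycle t o -> {in o &, forall x y, fconnect t x y}.
Proof. exact: connect_cycle. Qed.

Lemma fcycle_closed t o x y : fcycle t o -> fconnect t x y ->
  (x \in o) = (y \in o).
Proof.
move=> to xy; have sym := @fconnect_sym _ _ (@perm_inj _ t).
have cl a b : fconnect t a b -> a \in o -> b \in o.
  by move=> ab ao; rewrite -(fconnect_cycle to ao).
by apply/idP/idP; apply: cl; rewrite // sym.
Qed.

(* The vertices are the cycles of [s * t]: turning around one costs nothing,
   and crossing an edge costs 1. *)
Inductive near s t d0 : nat -> T -> Prop :=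
| near_base : near s t d0 0 d0
| near_turn n d : near s t d0 n d -> near s t d0 n ((s * t) d)
| near_opp n d : near s t d0 n d -> near s t d0 n.+1 (s d)
| near_succ n d : near s t d0 n d -> near s t d0 n.+1 d.

Lemma near_leq s t d0 m n d : m <= n -> near s t d0 m d -> near s t d0 n d.
Proof.
by move/subnK <-; elim: (n - m) => // i IHi /IHi; rewrite addSn; apply: near_succ.
Qed.

Lemma near_fconnect s t d0 n d e :
  near s t d0 n d -> fconnect (s * t) d e -> near s t d0 n e.
Proof.
move=> nd /connectP[p tp ->]; elim: p d nd tp => //= a p IHp d nd /andP[/eqP <-].
exact/IHp/near_turn.
Qed.

(** The hypothesis puts [x] and [y] at one vertex of the new map: vertices are merged, so old walks
    survive with the same number of crossings. *)
Lemma near_join s t d0 x y n d : fconnect (s * (t * tperm x y)) x y ->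
  near s t d0 n d -> near s (t * tperm x y) d0 n d.
Proof.
set t' := _ * tperm x y => xy; elim=> {n d} [|n d _ nd|n d _ nd|n d _ nd].
- exact: near_base.
- have -> : (s * t) d = tperm x y ((s * t') d) by rewrite !permM tpermK.
  have {}nd := near_turn nd.
  case: tpermP nd => // -> nd; apply: near_fconnect nd _ => //.
  by rewrite fconnect_sym //; apply: perm_inj.
- exact: near_opp.
- exact: near_succ.
Qed.

(* When [x] and [y] become disconnected, the walk from [d0] to [d] may be
   cut short at the component of [d0]: it leaves it only at [x] or [y]. *)
Lemma near_split s t d0 x y n d : ~~ connect (conn s (t * tperm x y)) x y ->
  near s t d0 n d -> connect (conn s (t * tperm x y)) d0 d ->
  near s (t * tperm x y) d0 n d.
Proof.
set t' := _ * tperm x y; set C := connect _ => xy nd.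
have Csym : symmetric C by apply: conn_sym.
have Ctrans : transitive C by apply: connect_trans.
(* Outside the component of [d0] the invariant remembers the exit point [z]. Only one of [x] and [y]
   lies in that component, so the walk can only re-enter at the same [z]. *)
suff : if C d0 d then near s t' d0 n d else
    exists z, [/\ z \in [:: x; y], C d0 z & near s t' d0 n z].
  by move=> + d0d; rewrite d0d.
elim: nd => {n d} [|n d _ IHd|n d _ IHd|n d _ IHd].
- by rewrite /C connect0; apply: near_base.
- have dt' : C d ((s * t') d) by apply: connect_permM.
  have e : (s * t) d = tperm x y ((s * t') d) by rewrite !permM tpermK.
  have {IHd} IHd : if C d0 ((s * t') d) then near s t' d0 n ((s * t') d) else
      exists z, [/\ z \in [:: x; y], C d0 z & near s t' d0 n z].
    have -> : C d0 ((s * t') d) = C d0 d.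
      by apply/idP/idP => H; apply: Ctrans H _ => //; rewrite Csym.
    by case: ifP IHd => // _; apply: near_turn.
  rewrite e; case: tpermP => [dx|dy|_ _]; last exact: IHd.
    rewrite dx in IHd; case: ifP IHd => [d0x nx|d0x [z [zxy d0z nz]]].
      have -> : C d0 y = false.
        by apply: contraNF xy => d0y; apply: Ctrans d0y; rewrite Csym.
      by exists x; rewrite !inE eqxx.
    case: ifP => [d0y|_]; last by exists z.
    by move: zxy; rewrite !inE => /pred2P[zE|<- //]; rewrite -zE d0z in d0x.
  rewrite dy in IHd; case: ifP IHd => [d0y ny|d0y [z [zxy d0z nz]]].
    have -> : C d0 x = false.
      by apply: contraNF xy => d0x; apply: Ctrans d0y; rewrite Csym.
    by exists y; rewrite !inE eqxx orbT.
  case: ifP => [d0x|_]; last by exists z.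
  by move: zxy; rewrite !inE => /pred2P[<- //|zE]; rewrite -zE d0z in d0y.
- have sd : C d (s d) by apply: connect_perml.
  have -> : C d0 (s d) = C d0 d.
    by apply/idP/idP => H; apply: Ctrans H _ => //; rewrite Csym.
  case: ifP IHd => [_|_ [z [zxy d0z nz]]]; first exact: near_opp.
  by exists z; split=> //; apply: near_succ.
- case: ifP IHd => [_|_ [z [zxy d0z nz]]]; first exact: near_succ.
  by exists z; split=> //; apply: near_succ.
Qed.

End Cycles.

(** * Cutting a cell off the outer boundary of a planar map *)

Section Soups.
Variables (X : eqType) (T : finType).
Implicit Types (lab : T -> letter X) (s t : {perm T}) (o : seq T).

(* A planar map with darts [T], edges [{d, s d}] and faces the cycles of [t], of
   which only the component of the base dart [d0] matters. *)
Record soup (P : word X -> Prop) lab s t (d0 : T) k o : Prop := Soup {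
  soupK : involutive s;
  soup_neq : forall d, s d != d;
  soup_lab : forall d, lab (s d) = inv_letter (lab d);
  soup_planar : planar s t;
  soup_uniq : uniq (d0 :: o);
  soup_cycle : fcycle t (d0 :: o);
  soup_face : forall d, d \notin d0 :: o -> connect (conn s t) d0 d ->
    exists c, [/\ d \in c, uniq c, fcycle t c & P (map lab c)];
  soup_near : forall d, connect (conn s t) d0 d -> near s t d0 k d
}.

(** One transposition splits the outer cycle into [x], now a face, and the rest. If the ends of [x]
    are distinct vertices, they are identified; if they coincide, the map falls apart there and only
    the component of [d0] is kept. *)
Lemma soup_split P lab s t d0 k u x v :
  x != [::] -> P (map lab x) -> soup P lab s t d0 k (u ++ x ++ v) ->
  exists t', soup P lab s t' d0 k (u ++ v).
Proof.
case: x => // x1 x _ Px [sK s_neq s_lab st_pl Uo to faces nears].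
(* [y1] is the dart after [x] on the outer cycle, which wraps around to [d0] when [v] is empty. *)
have [y1 [w wE]] : exists y1 w, v ++ d0 :: u = y1 :: w.
  by case: (v) => [|y1 w]; [exists d0, u | exists y1, (w ++ d0 :: u)].
have rotE : rot (size (d0 :: u)) (d0 :: u ++ (x1 :: x) ++ v) = x1 :: x ++ y1 :: w.
  by rewrite -!cat_cons rot_size_cat /= -catA wE.
have rotE' : rot (size v) (v ++ d0 :: u) = d0 :: u ++ v by rewrite rot_size_cat.
have memE z : (z \in d0 :: u ++ (x1 :: x) ++ v) = (z \in x1 :: x ++ y1 :: w).
  by rewrite -rotE mem_rot.
have memE' z : (z \in d0 :: u ++ v) = (z \in y1 :: w).
  by rewrite -rotE' mem_rot wE.
move: Uo to; rewrite -(rot_uniq (size (d0 :: u))) -(rot_cycle (size (d0 :: u))) rotE.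
move=> Uo to.
have xy : x1 != y1 by move: Uo; rewrite /= mem_cat inE !negb_or; case/andP=> /and3P[].
pose t' := t * tperm x1 y1; exists t'.
have [t'x t'y] := fcycle_split Uo to.
have txy : fconnect t x1 y1.
  by apply: (fcycle_fconnect to); rewrite !inE ?mem_cat ?inE eqxx ?orbT.
have sub a b : connect (conn s t') a b -> connect (conn s t) a b.
  apply: connect_sub => {a b} a b /orP[/eqP <-|/eqP <-]; first exact: connect_perml.
  apply: connect_trans (connect_permr _ _ _) _; rewrite permM.
  have cxy : connect (conn s t) x1 y1.
    by apply: fconnect_conn txy => z; apply: connect_permr.
  by case: tpermP => [->|->|_ _]; rewrite // conn_sym.
split=> //.
- by apply: planar_mulr_tperm xy st_pl _; rewrite txy.
- rewrite -rotE' rot_uniq wE.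
  by move: Uo; rewrite -cat_cons cat_uniq => /and3P[].
- by rewrite -rotE' rot_cycle wE.
- move=> d; rewrite memE' => dyw d0d.
  have [dx|dx] := boolP (d \in x1 :: x).
    exists (x1 :: x); split=> //.
    by move: Uo; rewrite -cat_cons cat_uniq => /and3P[].
  have dxy : d \notin x1 :: x ++ y1 :: w by rewrite -cat_cons mem_cat negb_or dx.
  have [|c [dc Uc tc Pc]] := faces d _ (sub _ _ d0d); first by rewrite memE.
  exists c; split=> //.
  have notc z : z \in x1 :: x ++ y1 :: w -> z \notin c.
    move=> zo; apply: contra dxy => zc; rewrite -(fcycle_closed to _ (x := z)) //.
    exact: (fcycle_fconnect tc).
  by apply: fcycle_mulr_tperm tc; apply: notc; rewrite !inE ?mem_cat ?inE eqxx ?orbT.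
- move=> d d0d; have nd := nears d (sub _ _ d0d).
  have [stxy|stxy] := boolP (fconnect (s * t) x1 y1).
    by apply: near_split nd d0d; apply: planar_split_disconnected.
  by apply: near_join nd; rewrite mulgA fconnect_mulr_tperm.
Qed.

End Soups.

(** * Gluing digons *)

Section Digon.
Variables (T : finType) (s t : {perm T}) (a b : T).
Hypotheses (sK : involutive s) (s_neq : forall d, s d != d).
Hypotheses (ab : a != b) (tab : t a = b) (tba : t b = a) (sab : s a != b).

(* Glues the two edges of the digon with boundary [a b] along each other; the
   darts [a] and [b] are left in a component of their own. *)
Definition glue_digon : {perm T} := s * tperm a (s b) * tperm (s a) b.

Let asb : a != s b.
Proof. by apply: contraNneq sab => ->; rewrite sK. Qed.

Let glueE z : glue_digon z =
  if z == a then b else if z == b then a else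
  if z == s a then s b else if z == s b then s a else s z.
Proof.
rewrite !permM; have inj := inj_eq (@perm_inj _ s).
have sbsa : s b != s a by rewrite inj eq_sym.
have [asa bsb] : a != s a /\ b != s b by rewrite !(eq_sym _ (s _)) !s_neq.
case: (z =P a) => [->|/eqP za].
  by rewrite [tperm a _ _]tpermD ?tpermL.
case: (z =P b) => [->|/eqP zb].
  by rewrite tpermR tpermD // eq_sym.
case: (z =P s a) => [->|/eqP zsa].
  by rewrite sK tpermL tpermD // eq_sym.
case: (z =P s b) => [->|/eqP zsb].
  by rewrite sK [tperm a _ _]tpermD ?tpermR // eq_sym.
have [saz sbz] : s z != s a /\ s z != s b by rewrite !inj.
have [az bz] : s z != a /\ s z != b.
  by split; [apply: contraNneq zsa|apply: contraNneq zsb] => <-; rewrite sK.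
by rewrite [tperm a _ _]tpermD ?tpermD // eq_sym.
Qed.

Lemma glue_digonK : involutive glue_digon.
Proof.
have inj := inj_eq (@perm_inj _ s).
have e1 : (a == b) = false by apply: negbTE.
have e2 : (b == a) = false by rewrite eq_sym.
have e3 : (s a == a) = false by apply: negbTE.
have e4 : (s b == b) = false by apply: negbTE.
have e5 : (s b == a) = false by rewrite eq_sym; apply: negbTE.
have e6 : (s a == b) = false by apply: negbTE.
move=> z; rewrite !glueE.
case: (z =P a) => [->|/eqP za]; first by rewrite e2 eqxx.
case: (z =P b) => [->|/eqP zb]; first by rewrite eqxx.
case: (z =P s a) => [->|/eqP zsa].
  by rewrite e5 e4 inj e2 eqxx.
case: (z =P s b) => [->|/eqP zsb].
  by rewrite e3 e6 eqxx.
rewrite !inj (negbTE za) (negbTE zb) sK.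
by rewrite ifN ?ifN //; [apply: contraNneq zsb|apply: contraNneq zsa] => <-; rewrite sK.
Qed.

Lemma glue_digon_neq z : glue_digon z != z.
Proof.
rewrite glueE; case: (z =P a) => [->|_]; first by rewrite eq_sym.
case: (z =P b) => [->|_] //.
case: (z =P s a) => [->|_]; first by rewrite (inj_eq (@perm_inj _ s)) eq_sym.
by case: (z =P s b) => [->|_] //; rewrite (inj_eq (@perm_inj _ s)).
Qed.

Lemma glue_digon_lab (X : Type) (lab : T -> letter X) :
  (forall d, lab (s d) = inv_letter (lab d)) -> lab b = inv_letter (lab a) ->
  forall d, lab (glue_digon d) = inv_letter (lab d).
Proof.
move=> lab_s lab_b z; rewrite glueE.
case: eqP => [->|_] //; case: eqP => [->|_]; first by rewrite lab_b inv_letterK.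
case: eqP => [->|_]; first by rewrite !lab_s lab_b.
by case: eqP => [->|_] //; rewrite !lab_s lab_b !inv_letterK.
Qed.

(** With the roles of edges and faces exchanged, both transpositions meet the planarity criterion:
    [t * s] sends [a] to [s b], and then [s * tperm a (s b)] sends [s a] to [s b] and [s b] to
    [b]. *)
Lemma glue_digon_planar : planar s t -> planar glue_digon t.
Proof.
rewrite !(planarC _ t) => pl; apply: planar_mulr_tperm => //.
  apply: planar_mulr_tperm => //; apply/orP; left; apply/orP; right.
  by apply: connect1; rewrite /= permM tab.
apply/orP; left; apply/orP; left.
apply: (@connect_trans _ _ (s b)); apply: connect1; rewrite /= permM.
  by rewrite sK tpermL.
by rewrite sK tpermD // eq_sym // s_neq.
Qed.

Lemma connect_glue_digon x y :
  connect (conn glue_digon t) x y -> connect (conn s t) x y.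
Proof.
apply: connect_sub => {x y} x _ /orP[|] /eqP <-; last exact: connect_permr.
have cab : connect (conn s t) a b by rewrite -tab connect_permr.
have ca : connect (conn s t) a (s a) by apply: connect_perml.
have cb : connect (conn s t) b (s b) by apply: connect_perml.
have cs : connect (conn s t) (s a) (s b).
  by rewrite conn_sym in ca; apply: connect_trans ca (connect_trans cab cb).
rewrite glueE; case: eqP => [->|_] //.
case: eqP => [->|_]; first by rewrite conn_sym.
case: eqP => [->|_] //; case: eqP => [->|_]; first by rewrite conn_sym.
exact: connect_perml.
Qed.

Lemma glue_digon_isolated d0 : d0 != a -> d0 != b ->
  ~~ connect (conn glue_digon t) d0 a.
Proof.
move=> da db; rewrite conn_sym; apply/negP => ad.
have cl : closed (conn glue_digon t) (pred2 a b).
  apply: intro_closed; first exact: conn_sym.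
  move=> x y /orP[|] /eqP <-; rewrite !inE => /pred2P[] ->.
  - by rewrite glueE eqxx eqxx orbT.
  - by rewrite glueE ifN 1?eq_sym // !eqxx.
  - by rewrite tab eqxx orbT.
  - by rewrite tba eqxx.
have := closed_connect cl ad; rewrite !inE eqxx /=.
by rewrite (negbTE da) (negbTE db).
Qed.

(** The new walk may not use [a] and [b]. The map [r] replaces them by [s b] and [s a], which start
    at the same vertices because [t b = a] and [t a = b]. *)
Lemma near_glue_digon d0 n d : d0 != a -> d0 != b -> near s t d0 n d ->
  d != a -> d != b -> near glue_digon t d0 n d.
Proof.
move=> d0a d0b nd; pose r z := if z == a then s b else if z == b then s a else z.
suff rd : near glue_digon t d0 n (r d).
  by move=> /negbTE da /negbTE db; move: rd; rewrite /r da db.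
have inj := inj_eq (@perm_inj _ s).
have e1 : (a == b) = false by apply: negbTE.
have e2 : (b == a) = false by rewrite eq_sym.
have e3 : (s a == a) = false by apply: negbTE.
have e4 : (s b == b) = false by apply: negbTE.
have e5 : (s b == a) = false by rewrite eq_sym; apply: negbTE.
have e6 : (s a == b) = false by apply: negbTE.
have rt z : z != a -> z != b -> r (t z) = t z.
  move=> za zb; rewrite /r -{1}tba -tab !(inj_eq (@perm_inj _ t)).
  by rewrite tab (negbTE za) (negbTE zb).
have rs z : r (s z) = glue_digon (r z).
  rewrite {2}/r; case: (z =P a) => [->|/eqP za].
    by rewrite glueE e5 e4 inj e2 eqxx /r e3 e6.
  case: (z =P b) => [->|/eqP zb]; first by rewrite glueE e3 e6 eqxx /r e5 e4.
  rewrite glueE (negbTE za) (negbTE zb) /r.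
  case: (z =P s a) => [->|/eqP zsa]; first by rewrite sK eqxx.
  case: (z =P s b) => [->|/eqP zsb]; first by rewrite sK e2 eqxx.
  rewrite !ifN //; [apply: contraNneq zsb|apply: contraNneq zsa] => <-; by rewrite sK.
elim: nd => {n d} [|n d _ IHd|n d _ IHd|n d _ IHd].
- by rewrite /r (negbTE d0a) (negbTE d0b); apply: near_base.
- rewrite permM.
  (* Turning from [s a] leads to [b], which [r] sends back to [s a], so this turn becomes void;
     likewise from [s b]. *)
  have [dsa|dsa] := eqVneq d (s a).
    by move: IHd; rewrite dsa sK tab /r e2 eqxx e3 e6.
  have [dsb|dsb] := eqVneq d (s b).
    by move: IHd; rewrite dsb sK tba /r eqxx e5 e4.
  have -> : r (t (s d)) = (glue_digon * t) (r d); last exact: near_turn.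
  rewrite permM -rs rt.
  + rewrite /r !ifN //.
      by apply: contraNneq dsb => <-; rewrite sK.
    by apply: contraNneq dsa => <-; rewrite sK.
  + by apply: contraNneq dsa => <-; rewrite sK.
  + by apply: contraNneq dsb => <-; rewrite sK.
- by rewrite rs; apply: near_opp.
- exact: near_succ.
Qed.

End Digon.

Definition digon (X : Type) (w : word X) : Prop := exists a, w = [:: a; inv_letter a].

(** Induction on the size of the base component: every digon that is closed takes its two darts out
    of it. *)
Lemma soup_glue (X : eqType) (T : finType) (P : word X -> Prop)
    (lab : T -> letter X) (s t : {perm T}) d0 k o :
  soup (fun w => P w \/ digon w) lab s t d0 k o ->
  exists s', soup P lab s' t d0 k o.
Proof.
have [n] := ubnP #|connect (conn s t) d0|; elim: n s => // n IHn s le_n sp.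
have [sK s_neq s_lab st_pl Uo to faces nears] := sp.
pose bad a := [&& connect (conn s t) d0 a, a \notin d0 :: o, t a != a,
  t (t a) == a & lab (t a) == inv_letter (lab a)].
have [/existsP[a /and5P[d0a ao ta tta /eqP lab_ta]]|nobad] := boolP [exists a, bad a].
  move/eqP: tta => tta; set b := t a in ta tta lab_ta.
  have ab : a != b by rewrite eq_sym.
  have bo : b \notin d0 :: o.
    by rewrite -(fcycle_closed to (_ : fconnect t a b)) // fconnect1.
  have [a0 b0] : d0 != a /\ d0 != b.
    by split; [apply: contraNneq ao|apply: contraNneq bo] => <-; rewrite inE eqxx.
  (* Otherwise [a] and [b] would form a component without [d0]. *)
  have sab : s a != b.
    apply/eqP => sab; have cl : closed (conn s t) (pred2 a b).
      apply: intro_closed; first exact: conn_sym.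
      move=> x y /orP[|] /eqP <-; rewrite !inE => /pred2P[] ->.
      - by rewrite sab eqxx orbT.
      - by rewrite -sab sK eqxx.
      - by rewrite -/b eqxx orbT.
      - by rewrite tta eqxx.
    have := closed_connect cl d0a; rewrite !inE eqxx /=.
    by rewrite (negbTE a0) (negbTE b0).
  have isolated : ~~ connect (conn (glue_digon s a b) t) d0 a.
    exact: glue_digon_isolated.
  have sub x y : connect (conn (glue_digon s a b) t) x y -> connect (conn s t) x y.
    exact: connect_glue_digon.
  apply: (IHn (glue_digon s a b)).
    rewrite ltnS in le_n; apply: leq_trans le_n; apply: proper_card.
    apply/properP; split; first by apply/subsetP => x; apply: sub.
    by exists a.
  split=> //.
  - exact: glue_digonK.
  - exact: glue_digon_neq.
  - exact: glue_digon_lab.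
  - exact: glue_digon_planar.
  - by move=> d do_ /sub; apply: faces.
  - move=> d d0d; apply: near_glue_digon => //; first exact/nears/sub.
      by apply: contraNneq isolated => da; rewrite da in d0d.
    apply: contraNneq isolated => db; rewrite db in d0d.
    by apply: connect_trans d0d _; rewrite -tta connect_permr.
exists s; split=> // d do_ d0d; have [c [dc Uc tc [Pc|[x]]]] := faces d do_ d0d.
  by exists c.
case: c => [|a [|b []]] // in dc Uc tc * => -[la lb].
move: Uc tc dc; rewrite /= !inE !andbT => ab /andP[/eqP tab /eqP tba] dab.
case/existsP: nobad.
have [lab_a lab_b] : lab a = inv_letter (lab b) /\ lab b = inv_letter (lab a).
  by rewrite lb la inv_letterK.
exists d; rewrite /bad d0d do_; case/orP: dab => /eqP ->.
  by rewrite tab tba lab_b eq_sym ab !eqxx.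
by rewrite tba tab lab_a ab !eqxx.
Qed.

(** * From planar maps to diagrams *)

Lemma adjacent_sym (V D : finType) (org : D -> V) (op : D -> D) :
  involutive op -> symmetric (adjacent org op).
Proof.
move=> opK u v; apply/existsP/existsP => -[d /andP[du dv]];
  by exists (op d); rewrite opK du dv.
Qed.

Lemma diameter_le (G : connected_graph) (u0 : vertex G) k :
  (forall v, exists p, [/\ path (adjacent (@origin G) (@opp G)) u0 p,
     last u0 p = v & size p <= k]) -> diameter G <= k.*2.
Proof.
move=> near_u0; apply/bigmax_leqP => u _; apply/bigmax_leqP => v _.
have [p [pP pu p_k]] := near_u0 u; have [q [qP qv q_k]] := near_u0 v.
have adjC := adjacent_sym (@origin G) (@oppK G).
pose r := rev (belast u0 p) ++ q.
have r_uv : has_walk u v (size r).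
  apply/existsP; exists (in_tuple r); rewrite /= cat_path last_cat.
  have -> : last u (rev (belast u0 p)) = u0.
    by case: (p) pu => [<-|a s] //= _; rewrite rev_cons last_rcons.
  rewrite qP qv eqxx -pu rev_path !andbT.
  by rewrite (eq_path (e' := adjacent (@origin G) (@opp G))) // => a b; apply: adjC.
rewrite /distance; case: ex_minnP => m _ /(_ _ r_uv) /leq_trans; apply.
by rewrite size_cat size_rev size_belast; lia.
Qed.

(** * Restriction of a planar map to a component *)

Section Restrict.
Variables (T : finType) (p : pred T).
Implicit Types r : {perm T}.

Definition stable r := forall d, p d -> p (r d).

Definition restr_fun r (rp : stable r) (d : {d | p d}) : {d | p d} :=
  exist _ (r (val d)) (rp _ (valP d)).

Lemma restr_inj r (rp : stable r) : injective (restr_fun rp).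
Proof. by move=> d e /(congr1 val) /= /perm_inj /val_inj. Qed.

Definition restr r (rp : stable r) : {perm {d | p d}} := perm (@restr_inj r rp).

Lemma val_restr r (rp : stable r) d : val (restr rp d) = r (val d).
Proof. by rewrite permE. Qed.

Lemma n_comp_restr (e : rel T) (e' : rel {d | p d}) :
  connect_sym e -> connect_sym e' -> closed e p ->
  (forall u v, e' u v = e (val u) (val v)) ->
  n_comp e p = n_comp e' {: {d | p d}}.
Proof.
move=> sym_e sym_e' cl_p e'E; rewrite (@adjunction_n_comp _ _ val _ e' sym_e sym_e' _ cl_p).
  by apply: eq_n_comp_r => u; rewrite !inE; apply: (valP u).
apply: (strict_adjunction sym_e' cl_p); first exact: val_inj.
  by apply/subsetP => u pu; apply/codomP; exists (exist _ u pu).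
by move=> u v _; rewrite e'E.
Qed.

Lemma cycles_restr r (rp : stable r) : fcard r p = cycles (restr rp).
Proof.
have sym q := @fconnect_sym _ _ (@perm_inj T q).
apply: n_comp_restr => //.
- by apply: fconnect_sym; apply: perm_inj.
- apply: intro_closed => // x y /eqP <-; exact: rp.
- by move=> u v; rewrite /= -val_eqE val_restr.
Qed.

Lemma comps_restr s t (sp : stable s) (tp : stable t) :
  n_comp (conn s t) p = comps (restr sp) (restr tp).
Proof.
apply: n_comp_restr; [exact: conn_sym|exact: conn_sym| |].
- apply: intro_closed; first exact: conn_sym.
  by move=> x y /orP[] /eqP <-; [apply: sp|apply: tp].
- by move=> u v; rewrite /conn /= -!val_eqE !val_restr.
Qed.

Lemma restrM s t (sp : stable s) (tp : stable t) (stp : stable (s * t)) :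
  restr sp * restr tp = restr stp.
Proof. by apply/permP => d; apply: val_inj; rewrite permM !val_restr permM. Qed.

Lemma stableM s t : stable s -> stable t -> stable (s * t).
Proof. by move=> sp tp d pd; rewrite permM; apply/tp/sp. Qed.

End Restrict.

(** The genus adds up over [p] and its complement and is nonnegative on both by [ree]; since the
    total is 0, both parts have genus 0. *)
Lemma planar_component (T : finType) (s t : {perm T}) (d0 : T)
    (p := connect (conn s t) d0) (sp : stable p s) (tp : stable p t) :
  planar s t ->
  cycles (restr sp) + cycles (restr tp) + cycles (restr sp * restr tp)
  = #|{: {d | p d}}| + 2.
Proof.
move=> pl; pose q := [predC p].
have cl_p : closed (conn s t) p by apply: connect_closed; apply: conn_sym.
have qE (r : {perm T}) : (forall d, conn s t d (r d)) -> stable q r.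
  move=> sr d /negP qd; apply/negP => prd; apply: qd.
  by have E : (d \in p) = (r d \in p) := cl_p _ _ (sr d); change (is_true (d \in p)); rewrite E.
have sq : stable q s by apply: qE => // d; rewrite /conn /= eqxx.
have tq : stable q t by apply: qE => // d; rewrite /conn /= eqxx orbT.
have cyc r (rp : stable p r) (rq : stable q r) :
    cycles r = cycles (restr rp) + cycles (restr rq).
  by rewrite -!cycles_restr /cycles (n_compC p).
have cst := cyc _ (stableM sp tp) (stableM sq tq).
have cmp : comps s t = 1%N + comps (restr sq) (restr tq).
  by rewrite -comps_restr /comps (n_compC p) n_comp_connect //; apply: conn_sym.
have cmp1 : comps (restr sp) (restr tp) = 1%N.
  by rewrite -comps_restr n_comp_connect //; apply: conn_sym.
have cT : #|T| = #|{: {d | p d}}| + #|{: {d | q d}}|.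
  by rewrite !card_sig -(cardC p).
have := ree (restr sp) (restr tp); rewrite cmp1.
have := ree (restr sq) (restr tq).
move: pl; rewrite /planar cst (cyc _ sp sq) (cyc _ tp tq) cmp cT !(restrM _ _ (stableM _ _)).
move: (cycles _) (cycles _) (cycles _) (cycles _) (cycles _) (cycles _) => a b c d e f.
move: (comps _ _) #|_| #|_|; lia.
Qed.

Lemma cell_label_rot (X : eqType) (R : seq (word X)) k u :
  cell_label R u -> cell_label R (rot k u).
Proof.
move=> [r [i [rR uE]]].
have rotE (w : word X) : exists j, rot k (rot i w) = rot j w.
  have [ki|ki] := leqP k (size w); last first.
    by exists i; rewrite [rot k _]rot_oversize // size_rot ltnW.
  have [iw|iw] := leqP i (size w); last first.
    by exists k; rewrite [rot i _]rot_oversize // ltnW.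
  by eexists; rewrite rot_add_mod.
by case: uE => ->; [have [j ->] := rotE r|have [j ->] := rotE (inv_word r)];
  exists r, j; split=> //; [left|right].
Qed.

Lemma orbit_cycle (T : finType) (f : T -> T) x o :
  uniq (x :: o) -> fcycle f (x :: o) -> orbit f x = x :: o.
Proof.
by move=> Uo fo; rewrite (orbitE fo Uo) ?inE ?eqxx //= eqxx rot0.
Qed.

Section SoupDiagram.
Variables (X : eqType) (R : seq (word X)) (T : finType) (lab : T -> letter X).
Variables (s t : {perm T}) (d0 : T) (k : nat) (o : seq T).
Hypothesis sp : soup (cell_label R) lab s t d0 k o.

Let p := connect (conn s t) d0.

Let ps : stable p s.
Proof. by move=> d pd; apply: connect_trans pd (connect_perml _ _ _). Qed.

Let pt : stable p t.
Proof. by move=> d pd; apply: connect_trans pd (connect_permr _ _ _). Qed.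

Let pst : stable p (s * t) := stableM ps pt.

Let K : finType := {d | p d}.
Let op : K -> K := restr ps.
Let turn : K -> K := restr pst.
Let inK d (pd : p d) : K := exist _ d pd.
Let base : K := inK (connect0 _ d0).

Let turn_inj : injective turn.
Proof. exact: perm_inj. Qed.

Let turn_sym : connect_sym (frel turn).
Proof. exact: fconnect_sym turn_inj. Qed.

Let V : finType := {d : K | froots turn d}.
Let org (d : K) : V := exist _ (froot turn d) (roots_root turn_sym d).

Let orgE d e : (org d == org e) = fconnect turn d e.
Proof. by rewrite -val_eqE /= root_connect. Qed.

Let opK : involutive op.
Proof. by move=> d; apply: val_inj; rewrite /op !val_restr (soupK sp). Qed.

Let op_neq d : op d != d.
Proof. by rewrite -val_eqE /op val_restr (soup_neq sp). Qed.

Let walk n d (pd : p d) : near s t d0 n d ->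
  exists q, [/\ path (adjacent org op) (org base) q,
    last (org base) q = org (inK pd) & size q <= n].
Proof.
move=> nd; elim: nd pd => {n d} [|n d _ IHd|n d _ IHd|n d _ IHd] pd.
- by exists [::]; split=> //=; congr (org _); apply: val_inj.
- have pd' : p d.
    apply: connect_trans pd _; rewrite conn_sym; exact: connect_permM.
  have [q [pq lq sq]] := IHd pd'; exists q; split=> //.
  rewrite lq; apply/eqP; rewrite orgE; apply: connect1; rewrite /= -val_eqE.
  by rewrite /turn val_restr.
- have pd' : p d by rewrite -(soupK sp d); apply: ps.
  have [q [pq lq sq]] := IHd pd'; exists (rcons q (org (inK pd))).
  rewrite rcons_path pq lq last_rcons size_rcons; split=> //=.
  apply/existsP; exists (inK pd'); rewrite eqxx /=.
  by apply/eqP; congr (org _); apply: val_inj; rewrite /op val_restr.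
- by have [q [pq lq sq]] := IHd pd; exists q; split=> //; apply: leqW.
Qed.

Let walk_to v : exists q, [/\ path (adjacent org op) (org base) q,
  last (org base) q = v & size q <= k].
Proof.
case: v => -[d pd] rd; have [q [pq lq sq]] := walk pd (soup_near sp pd).
exists q; split=> //; rewrite lq; apply: val_inj => /=.
exact/eqP.
Qed.

Let connected u v : connect (adjacent org op) u v.
Proof.
have c w : connect (adjacent org op) (org base) w.
  by have [q [pq <- _]] := walk_to w; apply/connectP; exists q.
apply: connect_trans (c v).
by rewrite (sym_connect_sym (adjacent_sym _ opK)).
Qed.

Let skel := ConnectedGraph opK op_neq connected.
Let face (d : K) := turn (op d).

Let val_face d : val (face d) = t (val d).
Proof.
by rewrite /face /turn /op !val_restr permM (soupK sp).
Qed.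

Let face_inj : injective face.
Proof. exact: inj_comp turn_inj (inv_inj opK). Qed.

Let orbit_face d : map val (orbit face d) = orbit t (val d).
Proof.
have : fcycle t (map val (orbit face d)).
  apply: homo_cycle (cycle_orbit face_inj d) => a b /eqP <-.
  by rewrite /= val_face.
have : uniq (map val (orbit face d)) by rewrite (map_inj_uniq val_inj) orbit_uniq.
rewrite /orbit -orderSpred /= => U C.
by rewrite -[LHS](orbit_cycle U C) /orbit -orderSpred.
Qed.

Let outer := orbit face base.

Let outerE : map val outer = d0 :: o.
Proof. by rewrite orbit_face (orbit_cycle (soup_uniq sp) (soup_cycle sp)). Qed.

Let euler_skel :
  #|V| + fcard face [predC outer] = (#|K|./2 + 1)%N.
Proof.
have pl := planar_component ps pt (soup_planar sp).
have cV : #|V| = cycles (restr pst) by rewrite card_sig; apply: eq_card => d; rewrite !inE andbT.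
have cE : #|K| = (cycles (restr ps)).*2.
  rewrite -muln2; apply/esym/fcard_order_set => //; first exact: perm_inj.
  apply/subsetP => d _; rewrite inE -size_orbit.
  rewrite (@orbit_cycle _ _ d [:: op d]) //= ?inE ?andbT 1?eq_sym ?op_neq //.
  by rewrite eqxx; apply/eqP/opK.
(* The successor counts the outer boundary, which is a single cycle. *)
have cF : cycles (restr pt) = (fcard face [predC outer]).+1.
  have -> : cycles (restr pt) = fcard face K.
    apply: eq_n_comp; apply: eq_connect => a b /=.
    by rewrite -!val_eqE val_restr val_face.
  rewrite (n_compC [in outer]) -add1n; congr (_ + _).
  rewrite -(n_comp_connect (fconnect_sym face_inj) base); apply: eq_n_comp_r => d.
  by rewrite -fconnect_orbit.
move: pl; rewrite (restrM _ _ pst) -cV cF -/K cE doubleK.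
move: (cycles _) #|V| (fcard _ _) => a b c; lia.
Qed.

Lemma soup_diagram : exists D : diagram R (map lab (d0 :: o)), diameter D <= k.*2.
Proof.
have lab_op (d : dart skel) : lab (val (opp d)) = inv_letter (lab (val d)).
  by rewrite [opp d]/(op d) /op val_restr (soup_lab sp).
have turn_orb (d e : dart skel) : fconnect turn d e = (origin d == origin e).
  by rewrite -orgE.
have cells_ok (d : dart skel) : d \notin outer ->
    cell_label R (map (fun d => lab (val d)) (orbit face d)).
  move=> d_out; rewrite (map_comp lab val) orbit_face.
  have [|c [dc Uc tc Pc]] := soup_face sp (d := val d) _ (valP d).
    by rewrite -outerE (mem_map val_inj).
  by rewrite (orbitE tc Uc dc) map_rot; apply: cell_label_rot.
have o_nil : outer = [::] -> #|dart skel| = 0%N by move=> o0; move: outerE; rewrite o0.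
have o_lab : map (fun d => lab (val d)) outer = map lab (d0 :: o).
  by rewrite (map_comp lab val) outerE.
pose D := @Diagram X R _ skel (fun d => lab (val d)) lab_op turn turn_inj turn_orb
  outer (orbit_uniq _ _) (cycle_orbit face_inj _) o_nil o_lab cells_ok euler_skel.
by exists D; apply: (@diameter_le skel (org base)); apply: walk_to.
Qed.

End SoupDiagram.

(** * Diagrams from products of conjugates *)

Definition no_rel (X : Type) (r : word X) : Prop := False.

Section Removal.
Variable X : eqType.
Implicit Types (a : letter X) (u v w x y z : word X) (P : word X -> Prop).

(** The word-level record of successive cuts along the outer boundary: each deleted subword becomes
    the label of a face, and it is nonempty because a cut starts at its first dart. *)
Inductive removal P : word X -> word X -> Prop :=
| removal_refl u : removal P u u
| removal_step u x v z : x != [::] -> P x -> removal P (u ++ v) z ->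
    removal P (u ++ x ++ v) z.

Lemma removal_trans P u v w : removal P u v -> removal P v w -> removal P u w.
Proof.
by elim=> // {v} u' x v z xN Px _ IH zw; apply: removal_step (IH zw).
Qed.

Lemma removal_ctx P y z u v : removal P u v -> removal P (y ++ u ++ z) (y ++ v ++ z).
Proof.
elim=> {u v} [u|u x v w xN Px _ IH]; first exact: removal_refl.
have := removal_step (u := y ++ u) (v := v ++ z) xN Px; rewrite -!catA; apply.
by rewrite !catA in IH *.
Qed.

Lemma removal_sub P Q u v : (forall x, P x -> Q x) -> removal P u v -> removal Q u v.
Proof.
move=> PQ; elim=> {u v} [u|u x v w xN Px _ IH]; first exact: removal_refl.
by apply: removal_step => //; apply: PQ.
Qed.

Lemma removal_cat P u u' v v' :
  removal P u u' -> removal P v v' -> removal P (u ++ v) (u' ++ v').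
Proof.
move=> /(removal_ctx [::] v) uu /(removal_ctx u' [::]).
by rewrite !cats0; apply: removal_trans uu.
Qed.

Definition push a s := if s is b :: s' then
  if b == inv_letter a then s' else a :: s else [:: a].

Definition free_reduce w := foldr push [::] w.

Definition reduced s := sorted (fun a b => b != inv_letter a) s.

Lemma push_reduced a s : reduced s -> reduced (push a s).
Proof.
case: s => //= b s bs; case: ifPn => [_|ba] /=; last by rewrite ba.
by case: s bs => //= c s /andP[].
Qed.

Lemma free_reduce_reduced w : reduced (free_reduce w).
Proof. by elim: w => //= a w; apply: push_reduced. Qed.

(** Van der Waerden's argument: a letter and its inverse act on reduced words by inverse maps, so
    [free_reduce] is invariant under free equality. *)
Lemma pushK a s : reduced s -> push a (push (inv_letter a) s) = s.
Proof.
case: s => [_|b s bs] /=; first by rewrite eqxx.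
rewrite inv_letterK; case: eqP => [ba|_] /=; last by rewrite eqxx.
by rewrite -ba; case: s bs => //= c s /andP[/negbTE ->].
Qed.

Lemma free_reduce_cat u v : free_reduce (u ++ v) = foldr push (free_reduce v) u.
Proof. exact: foldr_cat. Qed.

Lemma free_reduce_eq u v : pres_eq (@no_rel X) u v -> free_reduce u = free_reduce v.
Proof.
elim=> {u v} //; first by move=> v u w _ -> _ ->.
by move=> u a v; rewrite !free_reduce_cat /= pushK //; apply: free_reduce_reduced.
Qed.

Lemma removal_free_reduce w : removal (@digon X) w (free_reduce w).
Proof.
elim: w => [|a w IHw] /=; first exact: removal_refl.
apply: removal_trans (_ : removal _ (a :: free_reduce w) _).
  by have := removal_ctx [:: a] [::] IHw; rewrite !cats0.
case: (free_reduce w) => [|b s] /=; first exact: removal_refl.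
case: eqP => [->|_]; last exact: removal_refl.
by apply: (removal_step (u := [::]) (x := [:: a; inv_letter a])); [|exists a|apply: removal_refl].
Qed.

Lemma removal_free_trivial w : pres_eq (@no_rel X) w [::] -> removal (@digon X) w [::].
Proof. by move/free_reduce_eq => /= <-; apply: removal_free_reduce. Qed.

End Removal.

(** The darts [d0] and [o1] stay on the outer boundary, which protects the word to be kept. *)
Lemma soup_removal (X : eqType) (T : finType) P (lab : T -> letter X)
    (s t : {perm T}) d0 k o1 o2 w :
  soup P lab s t d0 k (o1 ++ o2) -> removal P (map lab o2) w ->
  exists t' o3, soup P lab s t' d0 k (o1 ++ o3) /\ map lab o3 = w.
Proof.
move=> sp; move zE: (map lab o2) => z rm.
elim: rm t o2 zE sp => {z w} [w|u x v w xN Px _ IH] t o2 oE sp; first by exists t, o2.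
have [ou [ox [ov [o2E uE xE vE]]]] : exists ou ox ov,
    [/\ o2 = ou ++ ox ++ ov, map lab ou = u, map lab ox = x & map lab ov = v].
  exists (take (size u) o2), (take (size x) (drop (size u) o2)),
    (drop (size x) (drop (size u) o2)).
  rewrite !map_take !map_drop oE !cat_take_drop take_size_cat // drop_size_cat //.
  by rewrite take_size_cat // drop_size_cat.
rewrite o2E in sp.
have [|||t' sp'] := @soup_split _ _ P lab s t d0 k (o1 ++ ou) ox ov.
- by case: (ox) xE xN => // <-.
- by rewrite xE.
- by rewrite -catA.
by apply: (IH t' (ou ++ ov)); rewrite ?map_cat ?uE ?vE // catA.
Qed.

(** * Plane trees with prescribed contour words *)

Section Contour.
Variable X : eqType.
Implicit Types (a : letter X) (w : word X) (u v c : seq (letter X * nat)).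

(** The default is the depth of the root, where a contour ends. *)
Definition first_height v := head 0%N (map snd v).

(* The contours of rooted plane trees with [m] edges, together with the depths of
   the vertices where the letters start. *)
Inductive contour : nat -> seq (letter X * nat) -> Prop :=
| contour1 a : contour 1 [:: (a, 0%N); (inv_letter a, 1%N)]
| contourS m u v a : u != [::] -> contour m (u ++ v) ->
    contour m.+1 (u ++ [:: (a, first_height v); (inv_letter a, (first_height v).+1)] ++ v).

Fixpoint spike h w := if w is a :: w' then
  (a, h) :: spike h.+1 w' ++ [:: (inv_letter a, h.+1)] else [::].

Lemma spike_word h w : map fst (spike h w) = w ++ inv_word w.
Proof.
elim: w h => //= a w IHw h; congr (_ :: _).
by rewrite map_cat IHw /inv_word /= rev_cons -cats1 catA.
Qed.

Lemma spike_height h w : all (fun b => b.2 <= h + size w) (spike h w).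
Proof.
elim: w h => //= a w IHw h; rewrite leq_addr all_cat /=.
by have := IHw h.+1; rewrite addSnnS => ->; rewrite addnS ltnS leq_addr.
Qed.

(** Each new edge is inserted between the two darts of the previous one, at the tip of the growing
    path. *)
Lemma contour_spike m u v w : u != [::] -> contour m (u ++ v) ->
  contour (m + size w) (u ++ spike (first_height v) w ++ v).
Proof.
elim: w m u v => [|a w IHw] m u v uN cuv /=; first by rewrite addn0.
have := contourS a uN cuv; set h := first_height v => cuav.
have := IHw m.+1 (u ++ [:: (a, h)]) ((inv_letter a, h.+1) :: v).
by rewrite addSnnS /= -!catA; apply; [case: (u)|].
Qed.

Definition flip_edge (N : nat) (d : 'I_N * bool) := (d.1, ~~ d.2).

Lemma flip_edgeK N : involutive (@flip_edge N).
Proof. by case=> i b; rewrite /flip_edge /= negbK. Qed.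

Definition flip_perm N : {perm 'I_N * bool} := perm (inv_inj (@flip_edgeK N)).

(** When the faces equal the edges, every edge is a sphere of its own. These spheres are the stock
    from which trees are built. *)
Lemma planar_flip_perm N : planar (flip_perm N) (flip_perm N).
Proof.
have sK : flip_perm N * flip_perm N = 1.
  by apply/permP => d; rewrite permM !permE flip_edgeK.
have cE : comps (flip_perm N) (flip_perm N) = cycles (flip_perm N).
  by apply: eq_n_comp; apply: eq_connect => u v; rewrite /conn /= orbb.
by rewrite /planar sK cE cycles1; lia.
Qed.

(** The dart type is fixed in advance, so a new leaf is an edge [e] taken from the isolated ones. It
    is attached by [tperm e y], where [y] is the dart after the insertion point; this joins two
    components, hence keeps planarity. As [u] is nonempty, [d0] remains first. *)
Lemma contour_map N m c : contour m c -> m <= N -> exists lab t d0 o ht,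
  let s := flip_perm N in
  [/\ forall d, lab (s d) = inv_letter (lab d), planar s t, uniq (d0 :: o),
     fcycle t (d0 :: o) & [/\ forall d, (d \in d0 :: o) = (d.1 < m),
     forall d : 'I_N * bool, m <= d.1 -> t d = s d,
     forall d, d \in d0 :: o -> near s t d0 (ht d) d &
     map (fun d => (lab d, ht d)) (d0 :: o) = c]].
Proof.
set s := flip_perm N; move=> cm; elim: cm => {m c} [a|m u v a uN _ IH] mN.
  pose e : 'I_N * bool := (Ordinal mN, false).
  exists (fun d => if d.2 then inv_letter a else a), s, e, [:: s e].
  exists (fun d => nat_of_bool d.2); split=> /=.
  - by case=> i []; rewrite /s permE /= ?inv_letterK.
  - exact: planar_flip_perm.
  - by rewrite inE /s permE.
  - by rewrite /s !permE flip_edgeK !eqxx.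
  split.
  - move=> [i b]; rewrite !inE /s permE /flip_edge /= !xpair_eqE -val_eqE /=.
    by case: b; rewrite ?andbT ?andbF ?orbF //=; lia.
  - by [].
  - move=> d; rewrite !inE => /pred2P[] ->; first exact: near_base.
    have -> : (s e).2 = true by rewrite /s permE.
    exact/near_opp/near_base.
  - by rewrite /s permE.
have [lab [t [d0 [o [ht]]]]] := IH (ltnW mN).
move=> [s_lab st_pl Uo to [oE tout nears cE]].
pose e : 'I_N * bool := (Ordinal mN, false).
have [ou [ov [oE' ouE ovE]]] : exists ou ov, [/\ o = ou ++ ov,
    map (fun d => (lab d, ht d)) (d0 :: ou) = u & map (fun d => (lab d, ht d)) ov = v].
  case: u uN cE {IH} => // b u _ [bE cE].
  exists (take (size u) o), (drop (size u) o).
  by rewrite cat_take_drop /= map_take map_drop cE take_size_cat // drop_size_cat // bE.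
have [y [q qE]] : exists y q, ov ++ d0 :: ou = y :: q.
  by case: (ov) => [|y1 q]; [exists d0, ou | exists y1, (q ++ d0 :: ou)].
have memE z : (z \in y :: q) = (z \in d0 :: o).
  by rewrite -qE oE' mem_cat !inE mem_cat orbCA (orbC (_ \in ov)).
have e_fresh d : d.1 = e.1 -> d \notin y :: q.
  by rewrite memE oE => ->; rewrite ltnn.
have se : s e = (e.1, true) by rewrite /s permE.
have sse : s (s e) = e by rewrite /s !permE flip_edgeK.
have e_fresh' : e \notin y :: q by apply: e_fresh.
have se_fresh : s e \notin y :: q by apply: e_fresh; rewrite se.
have Ue : uniq (e :: [:: s e] ++ y :: q).
  have Uq : uniq (y :: q) by rewrite -qE uniq_catC cat_cons -oE'.
  rewrite -cat_cons cat_uniq Uq andbT; apply/andP; split.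
    by rewrite /= inE se xpair_eqE andbF.
  apply/hasPn => z zq; rewrite !inE negb_or.
  by apply/andP; split; apply: contraTneq zq => ->.
have cyw : fcycle t (y :: q).
  by rewrite -qE -(rot_size_cat (d0 :: ou)) rot_cycle /= -oE'.
have ce : fcycle t [:: e; s e] by rewrite /= !tout ?se //= -?se ?sse !eqxx.
have Ce := fcycle_join (u := [:: s e]) Ue ce cyw.
set t' := t * tperm e y in Ce.
have rotE : rot (size (d0 :: ou)) (d0 :: ou ++ [:: e; s e] ++ ov) = [:: e; s e] ++ y :: q.
  by rewrite -cat_cons rot_size_cat -catA qE.
have ey : e != y by apply: contraNneq e_fresh' => ->; rewrite inE eqxx.
have clm : closed (conn s t) (fun d : 'I_N * bool => d.1 < m).
  apply: intro_closed; first exact: conn_sym.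
  move=> d _ /orP[|] /eqP <-; rewrite unfold_in => dm; rewrite unfold_in.
    by rewrite /s permE.
  by rewrite -oE -(fcycle_closed to (fconnect1 t d)) oE.
have nconn : ~~ connect (conn s t) e y.
  apply/negP => cey; have := closed_connect clm cey; rewrite !unfold_in ltnn.
  by rewrite -oE -memE inE eqxx.
have cst : fconnect (s * t') e y.
  rewrite mulgA fconnect_mulr_tperm //; apply: contra nconn.
  by apply: fconnect_conn => d; apply: connect_permM.
pose h := first_height v.
have near_y : near s t d0 h y.
  rewrite /h -ovE; case: (ov) qE oE' => [|y1 ov'] /= [<- _] oE'.
    exact: near_base.
  by apply: nears; rewrite oE' inE mem_cat !inE eqxx !orbT.
have near_e : near s t' d0 h e.
  apply: near_fconnect (near_join cst near_y) _.
  by rewrite fconnect_sym //; apply: perm_inj.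
pose lab' d := if d == e then a else if d == s e then inv_letter a else lab d.
pose ht' d := if d == e then h else if d == s e then h.+1 else ht d.
have see : (s e == e) = false by rewrite se; apply/eqP.
have old d : d \in d0 :: o -> (d == e) = false /\ (d == s e) = false.
  rewrite -memE => dyw.
  by split; apply: contraTF dyw => /eqP ->.
exists lab', t', d0, (ou ++ [:: e; s e] ++ ov), ht'; split.
- move=> d; rewrite /lab'; case: (d =P e) => [->|/eqP de]; first by rewrite see eqxx.
  case: (d =P s e) => [->|/eqP dse]; first by rewrite sse eqxx inv_letterK.
  rewrite !ifN //; first by apply: contraNneq de => sde; apply/eqP/(@perm_inj _ s).
  by apply: contraNneq dse => <-; rewrite /s !permE flip_edgeK.
- by apply: planar_mulr_tperm => //; rewrite nconn orbT.
- by rewrite -(rot_uniq (size (d0 :: ou))) rotE.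
- by rewrite -(rot_cycle (size (d0 :: ou))) rotE.
split.
- move=> d; rewrite -(mem_rot (size (d0 :: ou))) rotE mem_cat memE oE !inE ltnS [d.1 <= m]leq_eqVlt.
  congr (_ || _); apply/orP/eqP => [[] /eqP -> //|dm]; first by rewrite se.
  by rewrite se; case: d dm => i [] /= im; [right|left]; apply/eqP; congr pair; apply: val_inj.
- move=> d md; have sd1 : (s d).1 = d.1 by rewrite /s permE.
  have ym : y.1 < m by rewrite -oE -memE mem_head.
  rewrite permM tout ?(ltnW md) // tpermD //.
    by apply: contraTneq md => ed; rewrite -sd1 -ed /= ltnn.
  by apply: contraTneq ym => ->; rewrite sd1 -leqNgt ltnW.
- move=> d; rewrite -(mem_rot (size (d0 :: ou))) rotE mem_cat memE => /orP[|dO].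
    by rewrite !inE => /pred2P[] ->; rewrite /ht' ?see eqxx //; apply: near_opp.
  have [de dse] := old d dO; rewrite /ht' de dse.
  by apply: near_join cst (nears d dO).
- have mapE r : {subset r <= d0 :: o} ->
      map (fun d => (lab' d, ht' d)) r = map (fun d => (lab d, ht d)) r.
    move=> ro; apply/eq_in_map => d /ro /old[de dse].
    by rewrite /lab' /ht' de dse.
  rewrite -cat_cons !map_cat (mapE (d0 :: ou)) ?(mapE ov) ?ouE ?ovE.
  + by rewrite /= /lab' /ht' see !eqxx.
  + by move=> d dv; rewrite oE' inE mem_cat dv !orbT.
  + by move=> d; rewrite oE' !inE mem_cat => /orP[->|->] //; rewrite orbT.
Qed.

Lemma contour_soup P m c (k : nat) : contour m c -> all (fun b => b.2 <= k) c ->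
  exists (T : finType) (lab : T -> letter X) s t d0 o,
    soup P lab s t d0 k o /\ map lab (d0 :: o) = map fst c.
Proof.
move=> cm ck; have [lab [t [d0 [o [ht]]]]] := contour_map cm (leqnn m).
move=> [s_lab st_pl Uo to [oE _ nears cE]].
have all_o d : d \in d0 :: o by rewrite oE ltn_ord.
exists ('I_m * bool)%type, lab, (flip_perm m), t, d0, o; split; last first.
  by rewrite -cE -map_comp.
split=> //.
- by move=> d; rewrite !permE flip_edgeK.
- by case=> i b; rewrite permE xpair_eqE eqxx; case: b.
(* A tree has no face but the outer one. *)
- by move=> d; rewrite all_o.
- move=> d _; apply: near_leq (nears d (all_o d)).
  have := allP ck (lab d, ht d); apply.
  by rewrite -cE; apply/mapP; exists d.
Qed.

End Contour.

(** The initial tree has contour w w^-1 followed by words p r r^-1 p^-1. Cutting off every r^-1 as a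
    cell leaves w and a freely trivial word, which is removed by digons. *)
Lemma bounded_diagram (X : eqType) (R : seq (word X)) (w : word X)
    (L : seq (word X * word X)) (k : nat) :
  size w <= k ->
  (forall b, b \in L -> size (b.1 ++ b.2) <= k /\ (b.2 \in R \/ inv_word b.2 \in R)) ->
  pres_eq (@no_rel X) (inv_word w ++ flatten [seq b.1 ++ b.2 ++ inv_word b.1 | b <- L]) [::] ->
  exists D : diagram R w, diameter D <= k.*2.
Proof.
(* A soup has a base dart, so the empty word gets the one-vertex diagram separately. *)
case: w => [|a w] wk Lk wL.
  have conn u v : connect (adjacent (@of_void unit) (@of_void void)) u v.
    by case: u v => [] [].
  pose G := @ConnectedGraph unit void _ _ (fun d : void => match d with end)
    (fun d : void => match d with end) conn.
  have cells (f : void -> void) d : d \notin [::] ->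
    @cell_label X R (map (@of_void _) (orbit f d)) by case: d.
  have eul (f : void -> void) :
      #|{: unit}| + fcard f [predC [::]] = (#|{: void}|./2 + 1)%N.
    by rewrite card_unit card_void /= addn1; congr _.+1; apply: eq_card0; case.
  pose D := @Diagram X R [::] G (@of_void _) (fun d : void => match d with end)
    (@of_void _) (fun d : void => match d with end)
    (fun d : void => match d with end) [::] isT isT (fun _ => card_void) erefl
    (cells _) (eul _).
  exists D; apply: (@diameter_le G tt) => -[].
  by exists [::].
pose c := spike 0 (a :: w) ++ flatten [seq spike 0 (b.1 ++ b.2) | b <- L].
have [m cm] : exists m, contour m c.
  rewrite /c; have : exists m, contour m (spike 0 (a :: w)).
    exists (1 + size w)%N.
    by have := @contour_spike X 1 [:: (a, 0%N)] [:: (inv_letter a, 1%N)] w isT (contour1 a).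
  have : spike 0 (a :: w) != [::] by [].
  elim: (L) (spike 0 (a :: w)) => [|b L' IH] u uN [m cu]; first by rewrite cats0; exists m.
  rewrite /= catA; apply: IH; first by case: (u) uN.
  have := @contour_spike X m u [::] (b.1 ++ b.2) uN; rewrite !cats0 => /(_ cu).
  by exists (m + size (b.1 ++ b.2))%N.
have ck : all (fun b => b.2 <= k) c.
  have sub h (v : word X) : h + size v <= k -> all (fun b => b.2 <= k) (spike h v).
    move=> hv; apply: sub_all (spike_height h v) => b /leq_trans; exact.
  rewrite all_cat sub //=; apply/allP => b /flatten_mapP[p /Lk[pk _] bp].
  by have := allP (sub 0 _ pk) _ bp.
have [T [lab [s [t [d0 [o [sp oE]]]]]]] :=
  contour_soup (fun v => cell_label R v \/ digon v) cm ck.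
pose v := inv_word (a :: w) ++ flatten [seq b.1 ++ b.2 ++ inv_word b.1 | b <- L].
have cE : map fst c = (a :: w) ++ inv_word (a :: w) ++
    flatten [seq (b.1 ++ b.2) ++ inv_word b.2 ++ inv_word b.1 | b <- L].
  rewrite map_cat spike_word -catA map_flatten -map_comp; congr (_ ++ (_ ++ flatten _)).
  by apply: eq_map => b; rewrite /= spike_word inv_word_cat.
have [lab_d0 lab_o] : lab d0 = a /\ map lab o = w ++ inv_word (a :: w) ++
    flatten [seq (b.1 ++ b.2) ++ inv_word b.2 ++ inv_word b.1 | b <- L].
  by move: oE; rewrite cE => -[].
have rm : removal (fun v => cell_label R v \/ digon v) (map lab (drop (size w) o)) [::].
  rewrite map_drop lab_o drop_size_cat //.
  apply: removal_trans (removal_sub _ (removal_free_trivial wL)); last by right.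
  apply: removal_cat (removal_refl _ _) _.
  elim: L Lk {wL c cm ck v cE lab_o oE} => [|b L IH] Lk /=; first exact: removal_refl.
  apply: removal_cat; last by apply: IH => b' b'L; apply: Lk; rewrite inE b'L orbT.
  rewrite -!catA; have [_ bR] := Lk b (mem_head _ _).
  (* An empty relator leaves nothing to cut. *)
  have [b0|b0] := eqVneq b.2 [::]; first by rewrite b0; apply: removal_refl.
  have := removal_step (P := fun v => cell_label R v \/ digon v)
    (u := b.1 ++ b.2) (v := inv_word b.1) (x := inv_word b.2).
  rewrite -!catA; apply; last exact: removal_refl.
    by rewrite -size_eq0 size_rev size_map size_eq0.
  left; case: bR => bR; first by exists b.2, 0; rewrite !rot0; split=> //; right.
  by exists (inv_word b.2), 0; rewrite !rot0; split=> //; left.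
have sp' : soup (fun v => cell_label R v \/ digon v) lab s t d0 k
    (take (size w) o ++ drop (size w) o) by rewrite cat_take_drop.
have [t' [o3 [sp3 o3E]]] := soup_removal sp' rm.
case: o3 o3E sp3 => // _; rewrite cats0 => /soup_glue[s' /soup_diagram].
by rewrite /= map_take lab_o take_size_cat // lab_d0.
Qed.

(** * Null words of bounded radius *)

Section Morphism.
Variables (G H : groupType) (f : G -> H).
Hypothesis fM : {morph f : g h / g * h}.

Lemma morph_one : f 1 = 1.
Proof. by apply: (@mulgI _ (f 1)); rewrite -fM !mulg1. Qed.

Lemma morph_inv : {morph f : g / g^-1}.
Proof. by move=> g; apply: (@mulgI _ (f g)); rewrite -fM !mulgV morph_one. Qed.

Lemma morph_conj : {morph f : g h / g ^ h}.
Proof. by move=> g h; rewrite /conjg !fM morph_inv. Qed.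

End Morphism.

Section Evaluation.
Variable X : choiceType.
Implicit Types (H G : groupType) (w u v : word X).

Definition eval H (phi : X -> H) w : H :=
  \prod_(a <- w) (if a.2 then (phi a.1)^-1 else phi a.1).

Lemma eval_cat H (phi : X -> H) u v : eval phi (u ++ v) = eval phi u * eval phi v.
Proof. exact: big_cat. Qed.

Lemma eval_inv H (phi : X -> H) w : eval phi (inv_word w) = (eval phi w)^-1.
Proof.
elim: w => [|a w IHw]; first by rewrite /eval !big_nil invg1.
rewrite -cat1s inv_word_cat !eval_cat IHw invMg; congr (_ * _).
by rewrite /eval !big_seq1; case: a => x [] /=; rewrite ?invgK.
Qed.

Lemma eval_gen H (phi : X -> H) x : eval phi (gen_word x) = phi x.
Proof. exact: big_seq1. Qed.

Lemma eval_conj H (phi : X -> H) u v :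
  eval phi (conj_word u v) = eval phi u ^ eval phi v.
Proof. by rewrite /conj_word !eval_cat eval_inv. Qed.

Lemma eval_morph G H (f : G -> H) (phi : X -> G) w : {morph f : g h / g * h} ->
  f (eval phi w) = eval (f \o phi) w.
Proof.
move=> fM; elim: w => [|a w IHw]; first by rewrite /eval !big_nil morph_one.
rewrite -cat1s !eval_cat fM IHw; congr (_ * _).
by rewrite /eval !big_seq1; case: a => x [] //=; rewrite morph_inv.
Qed.

Lemma eq_eval H (phi psi : X -> H) w : phi =1 psi -> eval phi w = eval psi w.
Proof. by move=> e; apply: eq_bigr => a _; rewrite e. Qed.

Lemma eval_pres_eq (R : word X -> Prop) H (phi : X -> H) :
  (forall r, R r -> eval phi r = 1) ->
  forall u v, pres_eq R u v -> eval phi u = eval phi v.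
Proof.
move=> R1 u v; elim=> {u v} //; first by move=> v u w _ -> _ ->.
  move=> u a v; rewrite -cat1s -[[:: inv_letter a]]/(inv_word [:: a]) !eval_cat.
  by rewrite eval_inv mulgV mul1g.
by move=> u r v /R1 r1; rewrite !eval_cat r1 mul1g.
Qed.

End Evaluation.

Section VonDyck.
Variables (X : choiceType) (R : word X -> Prop).
Implicit Types (w u v : word X).

Lemma val_wordM u v : val_word R (u ++ v) = val_word R u * val_word R v.
Proof. exact/esym/pg_mulE. Qed.

Lemma val_wordV u : val_word R (inv_word u) = (val_word R u)^-1.
Proof. exact/esym/pg_invE. Qed.

Lemma val_word_eval w : val_word R w = eval (fun x => val_word R (gen_word x)) w.
Proof.
elim: w => [|a w IHw]; first by rewrite /eval big_nil.
rewrite -cat1s val_wordM IHw eval_cat; congr (_ * _).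
rewrite /eval big_seq1; case: a => x [] //=; rewrite -val_wordV //.
Qed.

Variables (H : groupType) (phi : X -> H).
Hypothesis phiR : forall r, R r -> eval phi r = 1.

Definition von_dyck (g : pres_group R) : H := eval phi (generic_quotient.repr g).

Lemma von_dyckE w : von_dyck (val_word R w) = eval phi w.
Proof. exact: (eval_pres_eq phiR (repr_val_word _ _)). Qed.

Lemma von_dyckM : {morph von_dyck : g h / g * h}.
Proof.
move=> g h; rewrite -(val_word_repr g) -(val_word_repr h) -val_wordM.
by rewrite !von_dyckE eval_cat.
Qed.

End VonDyck.

Section Fillings.
Variables (X : choiceType) (R : seq (word X)).

Notation free := (pres_group (@no_rel X)).
Notation pi := (val_word (@no_rel X)).
Implicit Types (g h s t : free) (w u v : word X) (k l n : nat).

Definition length_le n g := exists2 w, size w <= n & pi w = g.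

Lemma length_leW m n g : m <= n -> length_le m g -> length_le n g.
Proof. by move=> mn [w wm <-]; exists w => //; apply: leq_trans mn. Qed.

Lemma length_leM m n g h : length_le m g -> length_le n h -> length_le (m + n) (g * h).
Proof.
move=> [u um <-] [v vn <-]; exists (u ++ v); last exact: val_wordM.
by rewrite size_cat leq_add.
Qed.

Lemma length_leV n g : length_le n g -> length_le n g^-1.
Proof.
move=> [u un <-]; exists (inv_word u); last exact: val_wordV.
by rewrite size_rev size_map.
Qed.

Lemma length_le1 n : length_le n 1.
Proof. by exists [::]. Qed.

Lemma length_leX n m g : length_le n g -> length_le (n * m) (g ^+ m).
Proof.
move=> ng; elim: m => [|m IHm]; first by rewrite expg0 muln0; apply: length_le1.
by rewrite expgS mulnS; apply: length_leM.
Qed.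

Lemma length_le_ex g : exists n, length_le n g.
Proof.
by exists (size (generic_quotient.repr g)), (generic_quotient.repr g) => //;
  apply: val_word_repr.
Qed.

(* The loops of the Cayley complex of the presentation that contract within
   distance [k] of the base point, up to a constant. *)
Inductive null k : free -> Prop :=
| null1 : null k 1
| nullM g h : null k g -> null k h -> null k (g * h)
| nullV g : null k g -> null k g^-1
| null_rel p r : size p <= k -> r \in R -> null k (pi p * pi r * (pi p)^-1).

Lemma nullW k l g : k <= l -> null k g -> null l g.
Proof.
move=> kl; elim=> {g} [|g h _ ? _ ?|g _ ?|p r pk rR].
- exact: null1.
- exact: nullM.
- exact: nullV.
- by apply: null_rel rR; apply: leq_trans kl.
Qed.

Lemma null_conj k l g s : length_le l s -> null k g -> null (l + k) (s * g * s^-1).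
Proof.
move=> [u ul <-]; elim=> {g} [|g h _ IHg _ IHh|g _ IHg|p r pk rR].
- by rewrite mulg1 mulgV; apply: null1.
- by have := nullM IHg IHh; rewrite !mulgA mulgVK.
- by have := nullV IHg; rewrite !invMg invgK !mulgA.
- have -> : pi u * (pi p * pi r * (pi p)^-1) * (pi u)^-1 =
      pi (u ++ p) * pi r * (pi (u ++ p))^-1 by rewrite !val_wordM invMg !mulgA.
  by apply: null_rel; rewrite // size_cat leq_add.
Qed.

(** With the inverse on the right, a common right factor cancels at no cost, while a left factor
    conjugates and adds its length to the radius. *)
Definition near_eq k g h := null k (g * h^-1).

Lemma near_eqW k l g h : k <= l -> near_eq k g h -> near_eq l g h.
Proof. exact: nullW. Qed.

Lemma near_eq_refl k g : near_eq k g g.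
Proof. by rewrite /near_eq mulgV; apply: null1. Qed.

Lemma near_eq_sym k g h : near_eq k g h -> near_eq k h g.
Proof. by rewrite /near_eq => /nullV; rewrite invgF. Qed.

Lemma near_eq_trans k g h t : near_eq k g h -> near_eq k h t -> near_eq k g t.
Proof. by move=> gh /(nullM gh); rewrite divgKA. Qed.

Lemma near_eqMr k g h t : near_eq k g h -> near_eq k (g * t) (h * t).
Proof. by rewrite /near_eq mulgKA. Qed.

Lemma near_eqMl k l s g h : length_le l s -> near_eq k g h ->
  near_eq (l + k) (s * g) (s * h).
Proof. by rewrite /near_eq => ls /(null_conj ls); rewrite invMg !mulgA. Qed.

Lemma near_eqV k l g h : length_le l h -> near_eq k g h -> near_eq (l + k) g^-1 h^-1.
Proof.
move=> /length_leV lh /near_eq_sym /(null_conj lh).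
by rewrite /near_eq mulgA mulVg mul1g.
Qed.

Lemma near_eqJ k l g h s : length_le l s -> near_eq k g h ->
  near_eq (l + k) (g ^ s) (h ^ s).
Proof.
move=> /length_leV ls gh; rewrite !conjgE !mulgA.
exact/near_eqMr/near_eqMl.
Qed.

Definition to_pres : free -> pres_group (fin_rel R) :=
  von_dyck (fun x => val_word (fin_rel R) (gen_word x)).

Lemma no_relP (H : groupType) (phi : X -> H) (r : word X) : no_rel r -> eval phi r = 1.
Proof. by []. Qed.

Lemma to_presE w : to_pres (pi w) = val_word (fin_rel R) w.
Proof. by rewrite /to_pres von_dyckE ?val_word_eval //; apply: no_relP. Qed.

Lemma to_presM : {morph to_pres : g h / g * h}.
Proof. exact: von_dyckM (@no_relP _ _). Qed.

Lemma null_to_pres k g : null k g -> to_pres g = 1.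
Proof.
elim=> {g} [|g h _ gE _ hE|g _ gE|p r _ rR].
- exact: (morph_one to_presM).
- by rewrite to_presM gE hE mulg1.
- by rewrite (morph_inv to_presM) gE invg1.
- rewrite !to_presM (morph_inv to_presM) !to_presE.
  have -> : val_word (fin_rel R) r = 1.
    apply/val_wordP; have := pres_relator [::] [::] (rR : fin_rel R r).
    by rewrite /= cats0.
  by rewrite mulg1 mulgV.
Qed.

Lemma near_eq_to_pres k g h : near_eq k g h -> to_pres g = to_pres h.
Proof. by move/null_to_pres; rewrite to_presM (morph_inv to_presM) => /divg1_eq. Qed.

(** The radius is uncontrolled; this is meant for finitely many fixed equations, whose radii enter
    the constants. *)
Lemma to_pres_near_eq g h : to_pres g = to_pres h -> exists k, near_eq k g h.
Proof.
rewrite -(val_word_repr g) -(val_word_repr h) !to_presE => /val_wordP.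
elim=> {g h} [u|u v _ [k uv]|v u w _ [k uv] _ [l vw]|u a v|u r v rR].
- by exists 0%N; apply: near_eq_refl.
- by exists k; apply: near_eq_sym.
- exists (k + l)%N; apply: (@near_eq_trans _ _ (pi v)).
    by apply: near_eqW uv; apply: leq_addr.
  by apply: near_eqW vw; apply: leq_addl.
- exists 0%N; have -> : pi (u ++ [:: a; inv_letter a] ++ v) = pi (u ++ v).
    exact/val_wordP/pres_cancel.
  exact: near_eq_refl.
- exists (size u); rewrite /near_eq !val_wordM mulgA mulgKA.
  exact: null_rel.
Qed.

Lemma null_product k g : null k g -> exists L : seq (word X * word X),
  (forall b, b \in L -> size b.1 <= k /\ (b.2 \in R \/ inv_word b.2 \in R)) /\
  pi (flatten [seq b.1 ++ b.2 ++ inv_word b.1 | b <- L]) = g.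
Proof.
elim=> {g} [|g h _ [L [Lk <-]] _ [M [Mk <-]]|g _ [L [Lk <-]]|p r pk rR].
- by exists [::].
- exists (L ++ M); rewrite map_cat flatten_cat val_wordM; split=> // b.
  by rewrite mem_cat => /orP[/Lk|/Mk].
- exists (rev [seq (b.1, inv_word b.2) | b <- L]); split.
    by move=> b; rewrite mem_rev => /mapP[c /Lk[ck cR] ->]; rewrite inv_wordK; tauto.
  rewrite -val_wordV; congr val_word.
  elim: (L) => //= b L' IHL; rewrite rev_cons map_rcons -cats1 flatten_cat IHL.
  by rewrite !inv_word_cat inv_wordK /= cats0 -!catA.
- exists [:: (p, r)]; split; first by move=> b; rewrite inE => /eqP ->; tauto.
  by rewrite /= cats0 !val_wordM val_wordV mulgA.
Qed.

End Fillings.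

(** * Thompson's group *)

Section Generators.
Variable G : groupType.
Implicit Types a b : G.

(** The generator x_i of F in terms of x_0 = [a] and x_1 = [b]; the truncated predecessor gives
    exponent 0 for both. *)
Definition thompson_gen a b i : G := (if i is 0 then a else b) ^ (a ^+ i.-1).

Lemma thompson_gen0 a b : thompson_gen a b 0 = a.
Proof. by rewrite /thompson_gen expg0 conjg1. Qed.

Lemma thompson_gen_shift a b i n :
  thompson_gen a b (i.+1 + n) = thompson_gen a b i.+1 ^ (a ^+ n).
Proof. by rewrite /thompson_gen addSn /= expgnDr conjgM. Qed.

End Generators.

Lemma thompson_gen_morph (G H : groupType) (f : G -> H) a b i :
  {morph f : g h / g * h} -> f (thompson_gen a b i) = thompson_gen (f a) (f b) i.
Proof.
move=> fM; rewrite /thompson_gen (morph_conj fM); congr (_ ^ _); first by case: i.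
by elim: i.-1 => [|n IHn]; rewrite ?expg0 ?(morph_one fM) // !expgS fM IHn.
Qed.

(** * Fillings of linear radius for the relations of F *)

Section LinearRelations.
Variables (X : choiceType) (R : seq (word X)).
Notation free := (pres_group (@no_rel X)).
Variables (a b : free) (c : nat).
Hypotheses (len_a : length_le c a) (len_b : length_le c b).

Local Notation x := (thompson_gen a b).

Hypothesis rel2 : near_eq R c (x 2 * x 1) (x 1 * x 3).
Hypothesis rel3 : near_eq R c (x 3 * x 1) (x 1 * x 4).

Lemma length_gen i : length_le (c * (2 * i).+1) (x i).
Proof.
have la := length_leX i.-1 len_a; rewrite /thompson_gen conjgE.
have lb : length_le c (if i is 0 then a else b) by case: (i).
by apply: length_leW (length_leM (length_leV la) (length_leM lb la)); nia.
Qed.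

Lemma near_eq_shift k i j l m n :
  near_eq R k (x i.+1 * x j.+1) (x l.+1 * x m.+1) ->
  near_eq R (c * n + k) (x (i.+1 + n) * x (j.+1 + n)) (x (l.+1 + n) * x (m.+1 + n)).
Proof.
by rewrite !thompson_gen_shift -!conjMg; apply/near_eqJ/length_leX.
Qed.

(* [x_j] is rewritten as [x_(j-1) ^ x_2] by the relation for [j - 2] conjugated
   by [x_0], so that the radius grows by a constant at each step. *)
Lemma near_eq_gen1 j : near_eq R (10 * c * j.+2) (x j.+2 * x 1) (x 1 * x j.+3).
Proof.
elim/ltn_ind: j => -[|[|j]] IH; try by [apply: near_eqW rel2; nia|apply: near_eqW rel3; nia].
have rPB : near_eq R (c * 1 + 10 * c * j.+2) (x j.+3 * x 2) (x 2 * x j.+4).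
  by have := near_eq_shift 1 (IH j (leqnSn _)); rewrite !addn1.
have rQC : near_eq R (c * 2 + 10 * c * j.+2) (x j.+4 * x 3) (x 3 * x j.+1.+4).
  by have := near_eq_shift 2 (IH j (leqnSn _)); rewrite !addn2.
have rPA := IH j.+1 (leqnn _); have rBA := rel2.
have lB : length_le (5 * c) (x 2) by apply: length_leW (length_gen 2); nia.
have lA : length_le (3 * c) (x 1) by apply: length_leW (length_gen 1); nia.
have lP := length_gen j.+3; have {lB} lBV := length_leV lB.
move: rPB rQC rPA rBA lA lBV lP.
move: (x 1) (x 2) (x 3) (x j.+3) (x j.+4) (x j.+1.+4) => A B C P Q S.
move=> rPB rQC rPA rBA lA lBV lP.
(* The chain is QA = B^-1 P B A = B^-1 P A C = B^-1 A Q C = B^-1 A C S = A S. Shift and prefix cost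
   at most 10c beyond the radius for [j], and the prefix costs 5c beyond that for [j.+1], while the
   claimed bound grows by 20c and 10c. *)
have s1 : near_eq R (10 * c * j.+4) (Q * A) (B^-1 * P * (B * A)).
  have := near_eqMl lBV (near_eq_sym rPB) => /(near_eqMr A).
  by rewrite !mulgA mulVg mul1g; apply: near_eqW; nia.
have s2 : near_eq R (10 * c * j.+4) (B^-1 * P * (B * A)) (B^-1 * P * (A * C)).
  by apply: near_eqW (near_eqMl (length_leM lBV lP) rBA); nia.
have s3 : near_eq R (10 * c * j.+4) (B^-1 * P * (A * C)) (B^-1 * (A * Q) * C).
  have := near_eqMl lBV rPA => /(near_eqMr C).
  by rewrite !mulgA; apply: near_eqW; nia.
have s4 : near_eq R (10 * c * j.+4) (B^-1 * (A * Q) * C) (B^-1 * (A * C) * S).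
  have := near_eqMl (length_leM lBV lA) rQC.
  by rewrite !mulgA; apply: near_eqW; nia.
have s5 : near_eq R (10 * c * j.+4) (B^-1 * (A * C) * S) (A * S).
  have := near_eqMl lBV (near_eq_sym rBA) => /(near_eqMr S).
  by rewrite !mulgA mulVg mul1g; apply: near_eqW; nia.
apply: near_eq_trans s1 (near_eq_trans s2 (near_eq_trans s3 _)).
exact: near_eq_trans s4 s5.
Qed.

(** For [i = 0] the relation holds in the free group; otherwise it is a conjugate by a power of [a]
    of the case [i = 1]. *)
Lemma near_eq_gen i j : i < j -> near_eq R (10 * c * j) (x j * x i) (x i * x j.+1).
Proof.
case: i => [|i] ij.
  case: j ij => // j _; rewrite thompson_gen0 -[j.+2]addn1 thompson_gen_shift.
  by rewrite expg1 -conjgC; apply: near_eq_refl.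
have [k ->] : exists k, j = (k.+2 + i)%N by exists (j - i.+2); lia.
have := near_eq_shift i (near_eq_gen1 k); rewrite !addSn !add0n.
by apply: near_eqW; nia.
Qed.

End LinearRelations.

(** * Combing words into the normal form *)

Section Combing.
Variables (X : choiceType) (R : seq (word X)).
Notation free := (pres_group (@no_rel X)).
Variables (x : nat -> free) (M L : nat).

Definition gen_prod (p : seq nat) : free := \prod_(i <- p) x i.
Local Notation P := gen_prod.

Definition sorted_below n B p := [&& pairwise leq p, size p <= n & all (leq^~ B) p].

Hypothesis len_prod : forall p, sorted_below M M p -> length_le L (P p).
Hypothesis len_gen : forall i, i <= M -> length_le L (x i).
Hypothesis rel : forall i j, i < j -> j <= M ->
  near_eq R L (x j * x i) (x i * x j.+1).

Lemma gen_prod_cons i p : P (i :: p) = x i * P p.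
Proof. exact: big_cons. Qed.

Lemma gen_prod_cat p q : P (p ++ q) = P p * P q.
Proof. exact: big_cat. Qed.

Lemma gen_prod_rcons p i : P (rcons p i) = P p * x i.
Proof. by rewrite -cats1 gen_prod_cat /gen_prod big_seq1. Qed.

Lemma gen_prod_nil : P [::] = 1.
Proof. exact: big_nil. Qed.

Lemma pairwise_insert u b p : pairwise leq (u ++ p) -> all (leq^~ b) u ->
  all (leq b) p -> pairwise leq (u ++ b :: p).
Proof.
rewrite !pairwise_cat allrel_consr /= => /and3P[-> -> ->] -> ->.
by rewrite !andbT.
Qed.

Lemma sorted_below_catl n B u v : sorted_below n B (u ++ v) -> sorted_below n B u.
Proof.
rewrite /sorted_below pairwise_cat size_cat all_cat => /and3P[/and3P[_ -> _] s /andP[-> _]].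
by rewrite (leq_trans (leq_addr _ _) s).
Qed.

Lemma sorted_belowW m n A B p : m <= n -> A <= B -> sorted_below m A p -> sorted_below n B p.
Proof.
move=> mn AB /and3P[Sp sp pA]; rewrite /sorted_below Sp (leq_trans sp mn) /=.
by apply: sub_all pA => i iA; apply: leq_trans AB.
Qed.

(** The bound 2L, rather than L, covers the prefixes [P p * (P t)^-1] of [insert_right]. *)
Lemma near_eq_ctx k s t g h : length_le (L + L) s -> near_eq R k g h ->
  near_eq R (L + L + k) (s * g * t) (s * h * t).
Proof. by move=> ls gh; apply/near_eqMr/near_eqMl. Qed.

Lemma length_prefix p : sorted_below M M p -> length_le (L + L) (P p).
Proof. by move=> /len_prod; apply: length_leW; apply: leq_addr. Qed.

Lemma swap_gen_lt i b : i < b -> b <= M ->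
  near_eq R (L + L) ((x b)^-1 * x i) (x i * (x b.+1)^-1).
Proof.
move=> ib bM; apply: near_eq_sym.
have := near_eqMl (length_leV (len_gen bM)) (rel ib bM) => /(near_eqMr (x b.+1)^-1).
by rewrite mulKg -!mulgA mulgV mulg1 => /near_eq_sym /near_eq_sym.
Qed.

Lemma swap_gen_gt i b : b < i -> i <= M ->
  near_eq R (L + L) ((x b)^-1 * x i) (x i.+1 * (x b)^-1).
Proof.
move=> bi iM; have bM := leq_trans (ltnW bi) iM.
have := near_eqMl (length_leV (len_gen bM)) (rel bi iM) => /(near_eqMr (x b)^-1).
by rewrite mulKg mulgA mulgK.
Qed.

Lemma swap_gen_inv j b : b < j -> j < M ->
  near_eq R (L + L + L) ((x b)^-1 * (x j)^-1) ((x j.+1)^-1 * (x b)^-1).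
Proof.
move=> bj jM; rewrite -!invMg; apply: near_eqV (rel bj (ltnW jM)).
by apply: length_leM; apply: len_gen; lia.
Qed.

(** The letter moves right past smaller ones, and each passage raises its index by one; hence the
    invariant [b + size p <= B]. *)
Lemma insert_left u b p B : pairwise leq (u ++ p) -> all (leq^~ b) u ->
  all (leq^~ B) (u ++ p) -> b + size p <= B -> B <= M -> size u + size p < M ->
  exists2 q, sorted_below (size u + size p).+1 B q &
    near_eq R (L + L + L) (P u * x b * P p) (P q).
Proof.
elim: p u b => [|i p IHp] u b Sup ub upB bB BM sM.
  exists (rcons u b).
    move: Sup upB bB; rewrite /= !cats0 !addn0 => Su uB bB.
    by rewrite /sorted_below pairwise_rcons Su ub size_rcons all_rcons bB uB leqnn.
  by rewrite gen_prod_rcons gen_prod_nil mulg1; apply: near_eq_refl.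
have [bi|ib] := leqP b i.
  exists (u ++ b :: i :: p); last first.
    by rewrite gen_prod_cat (gen_prod_cons b) mulgA; apply: near_eq_refl.
  rewrite /sorted_below pairwise_insert //=.
    rewrite size_cat /= !addnS leqnn /=.
    by move: upB; rewrite !all_cat /= => /and3P[-> -> ->]; rewrite andbT; lia.
  rewrite bi /=; move: Sup; rewrite pairwise_cat /= => /and4P[_ _ ip _].
  by apply: sub_all ip => k; apply: leq_trans.
have [||||||q qn qE] := IHp (rcons u i) b.+1; rewrite ?cat_rcons //.
- by rewrite all_rcons (leqW (ltnW ib)) /=; apply: sub_all ub => k; apply: leqW.
- by move: bB => /=; lia.
- by rewrite size_rcons; move: sM => /=; lia.
exists q; first by move: qn; rewrite size_rcons /= addSnnS.
apply: near_eq_trans qE; rewrite gen_prod_rcons gen_prod_cons.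
have -> : P u * x b * (x i * P p) = P u * (x b * x i) * P p by rewrite !mulgA.
have -> : P u * x i * x b.+1 * P p = P u * (x i * x b.+1) * P p by rewrite !mulgA.
apply: near_eq_ctx; last by apply: rel => //; lia.
apply/length_prefix/(@sorted_below_catl _ _ u (i :: p)).
rewrite /sorted_below Sup size_cat (ltnW sM) /=.
by apply: sub_all upB => k kB; apply: leq_trans BM.
Qed.

Lemma shift_left p u b : all (fun i => b < i < M) p -> sorted_below M M (u ++ map S p) ->
  near_eq R (4 * L) (P u * (x b)^-1 * P p) (P (u ++ map S p) * (x b)^-1).
Proof.
elim: p u => [|i p IHp] u.
  by rewrite cats0 gen_prod_nil mulg1 => _ _; apply: near_eq_refl.
move=> /= /andP[/andP[bi iM] bp] nup.
have := IHp (rcons u i.+1) bp; rewrite cat_rcons => /(_ nup).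
apply: near_eq_trans; rewrite gen_prod_rcons gen_prod_cons.
have -> : P u * (x b)^-1 * (x i * P p) = P u * ((x b)^-1 * x i) * P p by rewrite !mulgA.
have -> : P u * x i.+1 * (x b)^-1 * P p = P u * (x i.+1 * (x b)^-1) * P p by rewrite !mulgA.
apply: near_eqW (near_eq_ctx _ _ (swap_gen_gt bi (ltnW iM))); first lia.
exact/length_prefix/(sorted_below_catl nup).
Qed.

(** Smaller letters raise the index of the inverse letter, an equal one cancels it, and larger ones
    let it pass and are shifted up by one. The strict bound [gtn B] leaves room for this shift. *)
Lemma divide_left n B p b u : sorted_below n B (u ++ p) -> all (gtn B) (u ++ p) ->
  b + size p <= B -> B <= M -> n <= M ->
  exists2 q, sorted_below n B q &
    near_eq R (4 * L) (P u * (x b)^-1 * P p) (P q) \/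
    exists2 b', b' <= B & near_eq R (4 * L) (P u * (x b)^-1 * P p) (P q * (x b')^-1).
Proof.
move=> nup ltB + BM nM; elim: p b u nup ltB => [|i p IHp] b u nup ltB bB.
  exists u; first by rewrite cats0 in nup.
  right; exists b; first by rewrite addn0 in bB.
  by rewrite gen_prod_nil mulg1; apply: near_eq_refl.
have [ib|bi|ib] := ltngtP i b.
- have [|||q nq qE] := IHp b.+1 (rcons u i); rewrite ?cat_rcons //.
    by move: bB => /=; lia.
  exists q => //.
  have e : near_eq R (4 * L) (P u * (x b)^-1 * P (i :: p))
      (P (rcons u i) * (x b.+1)^-1 * P p).
    rewrite gen_prod_rcons gen_prod_cons.
    have -> : P u * (x b)^-1 * (x i * P p) = P u * ((x b)^-1 * x i) * P p by rewrite !mulgA.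
    have -> : P u * x i * (x b.+1)^-1 * P p = P u * (x i * (x b.+1)^-1) * P p by rewrite !mulgA.
    have bM : b <= M by lia.
    apply: near_eqW (near_eq_ctx _ _ (swap_gen_lt ib bM)); first lia.
    exact/length_prefix/(sorted_belowW nM BM)/(sorted_below_catl nup).
  case: qE => [qE|[b' b'B qE]]; [left|right; exists b' => //]; exact: near_eq_trans qE.
- have nq : sorted_below n B (u ++ map S (i :: p)).
    move: nup ltB; rewrite /sorted_below !pairwise_cat !size_cat size_map !all_cat !all_map.
    case/and3P=> /and3P[up -> Sp] -> /andP[-> _] /andP[_ ->]; rewrite !andbT.
    have -> : pairwise leq (map S (i :: p)) by rewrite pairwise_map.
    rewrite !andbT; apply/allrelP => j k ju /mapP[l lp ->].
    by apply: leqW; apply: (allrelP up).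
  exists (u ++ map S (i :: p)) => //; right; exists b; first by lia.
  apply: shift_left (sorted_belowW nM BM nq); apply/allP => k kp.
  have kB : k < B by move/allP: ltB; apply; rewrite mem_cat kp orbT.
  rewrite (leq_trans kB BM) andbT; move: kp; rewrite inE => /predU1P[-> //|kp].
  apply: leq_trans bi _; move: nup; rewrite /sorted_below pairwise_cat /=.
  by case/andP=> /and4P[_ _ /allP/(_ _ kp)].
- exists (u ++ p).
    move: nup; rewrite /sorted_below !pairwise_cat !size_cat !all_cat allrel_consr /= addnS.
    case/and3P=> /and4P[/andP[_ ->] -> _ ->] sn /and3P[-> _ ->].
    by rewrite ltnW.
  left; rewrite ib gen_prod_cat gen_prod_cons -!mulgA mulKg.
  exact: near_eq_refl.
Qed.

Let five_L : L + L + (L + L + L) <= 5 * L.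
Proof. lia. Qed.

(** The letters of [q] are taken from its end: one with index [j > b] crosses the inverse of x_b as
    [j.+1] and is collected in [t]. The prefix accounts for 2L of the radius and the swap for 3L. *)
Lemma insert_right q t b p B : sorted_below M M p ->
  pairwise leq q -> pairwise leq t -> allrel ltn q t -> all (ltn b) t ->
  all (gtn B) q -> all (leq^~ B) t -> b <= B -> B <= M -> size q + size t < M ->
  exists2 q', sorted_below (size q + size t).+1 B q' &
    near_eq R (5 * L) (P p * (P t)^-1 * (x b)^-1 * (P q)^-1) (P p * (P q')^-1).
Proof.
move=> np; elim/last_ind: q t b => [|q j IHq] t b Sq St qt bt qB tB bB BM sM.
  exists (b :: t).
    rewrite /sorted_below /= St tB bB leqnn !andbT.
    by apply: sub_all bt => k; apply: ltnW.
  rewrite gen_prod_nil invg1 mulg1 gen_prod_cons invMg mulgA.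
  exact: near_eq_refl.
have := Sq; rewrite pairwise_rcons => /andP[qj Sq'].
have [jb|bj] := leqP j b.
  exists (rcons q j ++ b :: t); last first.
    by rewrite gen_prod_cat gen_prod_cons !invMg !mulgA; apply: near_eq_refl.
  rewrite /sorted_below pairwise_insert /=.
  - rewrite size_cat /= addnS leqnn /= all_cat /= bB tB !andbT.
    by apply: sub_all qB => k; apply: ltnW.
  - rewrite pairwise_cat Sq St !andbT; apply: sub_allrel qt => k l; exact: ltnW.
  - rewrite all_rcons jb; apply: sub_all qj => k kj; exact: leq_trans jb.
  - by apply: sub_all bt => k; apply: ltnW.
move: qt qB sM; rewrite all_rcons size_rcons => qt /andP[jB qB] sM.
have [qt' jt] : allrel ltn q t /\ all (ltn j) t.
  split.
    by apply/allrelP => k l kq lt; apply: (allrelP qt); rewrite // mem_rcons inE kq orbT.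
  by apply/allP => l lt; apply: (allrelP qt); rewrite // mem_rcons mem_head.
have [|||||||||q' nq' q'E] := IHq (j.+1 :: t) b.
- exact: Sq'.
- by rewrite /= St andbT.
- by rewrite allrel_consr qt' andbT; apply: sub_all qj => k.
- by rewrite /= bt andbT ltnW.
- exact: qB.
- by rewrite /= tB andbT.
- exact: bB.
- exact: BM.
- by rewrite /= addnS.
exists q'; first by move: nq'; rewrite /= addnS.
apply: near_eq_trans q'E; rewrite gen_prod_rcons gen_prod_cons !invMg.
have -> : P p * (P t)^-1 * (x b)^-1 * ((x j)^-1 * (P q)^-1) =
  P p * (P t)^-1 * ((x b)^-1 * (x j)^-1) * (P q)^-1 by rewrite !mulgA.
have -> : P p * ((P t)^-1 * (x j.+1)^-1) * (x b)^-1 * (P q)^-1 =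
  P p * (P t)^-1 * ((x j.+1)^-1 * (x b)^-1) * (P q)^-1 by rewrite !mulgA.
have jM : j < M by apply: leq_trans BM.
apply: near_eqW five_L (near_eq_ctx _ _ (swap_gen_inv bj jM)).
apply: length_leM; first exact: len_prod.
apply/length_leV/len_prod; rewrite /sorted_below St /=.
have -> : size t <= M by apply: leq_trans (leq_addl _ _) (ltnW sM).
by apply: sub_all tB => k kB; apply: leq_trans BM.
Qed.

(** A positive letter is inserted into [p]. An inverse letter either cancels inside [p] or emerges
    on its right and is then inserted into [q]. *)
Lemma comb_letter n B p q i (e : bool) : sorted_below n B p -> sorted_below n B q ->
  i + n <= B -> B < M -> n < M ->
  exists p' q', [/\ sorted_below n.+1 B.+1 p', sorted_below n.+1 B.+1 q' &
    near_eq R (5 * L) ((if e then (x i)^-1 else x i) * (P p * (P q)^-1))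
      (P p' * (P q')^-1)].
Proof.
move=> np nq iB BM nM; have /and3P[Sp sp pB] := np; have /and3P[Sq sq qB] := nq.
have ltB r : all (leq^~ B) r -> all (gtn B.+1) r by [].
case: e; rewrite mulgA.
  have [|||||p1 n1 [e1|[b bB e1]]] := @divide_left n B.+1 p i [::].
  - exact: sorted_belowW np.
  - exact: ltB.
  - by apply: leqW; apply: leq_trans iB; rewrite leq_add2l.
  - exact: BM.
  - exact: ltnW.
  - exists p1, q; split; [exact: sorted_belowW n1|exact: sorted_belowW nq|].
    rewrite gen_prod_nil mul1g in e1.
    by apply: near_eqW (near_eqMr (P q)^-1 e1); rewrite leq_mul2r leqnSn orbT.
  have [||||||||||q1 nq1 e2] := @insert_right q [::] b p1 B.+1.
  - exact: sorted_belowW (ltnW nM) BM n1.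
  - exact: Sq.
  - by [].
  - exact: allrel0r.
  - by [].
  - exact: ltB.
  - by [].
  - exact: bB.
  - exact: BM.
  - by rewrite addn0; apply: leq_ltn_trans nM.
  exists p1, q1; split; first exact: sorted_belowW n1.
    by apply: sorted_belowW nq1 => //; rewrite addn0.
  rewrite gen_prod_nil mul1g in e1; rewrite gen_prod_nil invg1 mulg1 in e2.
  apply: near_eq_trans e2.
  by apply: near_eqW (near_eqMr (P q)^-1 e1); rewrite leq_mul2r leqnSn orbT.
have [||||||p1 n1 e1] := @insert_left [::] i p B.
- exact: Sp.
- by [].
- exact: pB.
- by apply: leq_trans iB; rewrite leq_add2l.
- exact: ltnW.
- exact: leq_ltn_trans nM.
exists p1, q; split; [by apply: sorted_belowW n1; rewrite ?add0n|exact: sorted_belowW nq|].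
rewrite gen_prod_nil mul1g in e1.
by apply: near_eqW (near_eqMr (P q)^-1 e1); lia.
Qed.

(** Letters are absorbed from last to first, so each rewriting takes place behind the uncombed
    prefix, of length at most [size w * K]. Here [K] depends only on the indices that occur in [w],
    not on the larger ones created by combing. *)
Lemma comb J K w : (forall i, i <= J -> length_le K (x i)) ->
  all (fun a => a.1 <= J) w -> J + size w <= M ->
  exists p q, [/\ sorted_below (size w) (J + size w) p,
    sorted_below (size w) (J + size w) q &
    near_eq R (5 * L + size w * K) (eval x w) (P p * (P q)^-1)].
Proof.
move=> len_J; elim: w => [|a w IHw] /=.
  exists [::], [::]; split=> //.
  by rewrite gen_prod_nil mulgV /eval big_nil; apply: near_eq_refl.
move=> /andP[aJ wJ]; rewrite addnS => JM.
have [p [q [np nq e]]] := IHw wJ (ltnW JM).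
have [|||p' [q' [np' nq' e']]] := @comb_letter _ _ p q a.1 a.2 np nq.
- by rewrite leq_add2r.
- exact: JM.
- by apply: leq_ltn_trans JM; apply: leq_addl.
exists p', q'; split=> //.
apply: near_eq_trans (near_eqW _ e'); last exact: leq_addr.
rewrite -cat1s eval_cat /eval big_seq1 -/(eval x w) mulSn addnCA.
apply: near_eqMl e.
by case: (a.2); [apply: length_leV|]; apply: len_J.
Qed.

End Combing.

(** * Uniqueness of sorted words by the action on the line *)

Module Slope.
Import order ssralg ssrnum ssrint rat lra.
Import Order.TTheory GRing.Theory Num.Theory.
Local Open Scope ring_scope.

(* The generators of F as piecewise linear homeomorphisms of the line: slope 2
   on [i, i + 1], the identity to the left and a translation to the right. *)
Definition slope (i : nat) (t : rat) : rat :=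
  if t <= i%:R then t else if t <= i%:R + 1 then t + t - i%:R else t + 1.

Definition slope_inv (i : nat) (t : rat) : rat :=
  if t <= i%:R then t else if t <= i%:R + 2 then (t + i%:R) / 2 else t - 1.

Lemma slopeK i : cancel (slope i) (slope_inv i).
Proof.
move=> t; rewrite /slope /slope_inv.
by case: (leP t i%:R) => ti; [rewrite ti|case: (leP t (i%:R + 1)) => ti1];
  repeat case: ifP; lra.
Qed.

Lemma slope_invK i : cancel (slope_inv i) (slope i).
Proof.
move=> t; rewrite /slope /slope_inv.
by case: (leP t i%:R) => ti; [rewrite ti|case: (leP t (i%:R + 2)) => ti1];
  repeat case: ifP; lra.
Qed.

Lemma slope_rel i j t : (i < j)%N -> slope i (slope j t) = slope j.+1 (slope i t).
Proof.
rewrite -(ler_nat rat) -[i.+1]addn1 -[j.+1]addn1 !natrD /slope => ij.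
by repeat case: ifP; lra.
Qed.

Definition act (w : word nat) (t : rat) : rat :=
  foldl (fun t a => if a.2 then slope_inv a.1 t else slope a.1 t) t w.

Lemma act_cat u v t : act (u ++ v) t = act v (act u t).
Proof. exact: foldl_cat. Qed.

Lemma act_pres_eq u v : pres_eq thompson_rel u v -> act u =1 act v.
Proof.
elim=> {u v} [u|u v _ uv|v u w _ uv _ vw|u [i []] v|u r v [i [j [ij ->]]]] t //.
- by rewrite uv vw.
- by rewrite !act_cat /= slope_invK.
- by rewrite !act_cat /= slopeK.
- rewrite !act_cat; congr act.
  by rewrite /= slope_rel // slope_invK slopeK.
Qed.

Definition pos_word (p : seq nat) : word nat := [seq (i, false) | i <- p].

Lemma act_ge p t : t <= act (pos_word p) t.
Proof.
elim: p t => //= i p IHp t; apply: le_trans (IHp _).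
by rewrite /slope; repeat case: ifP; lra.
Qed.

Lemma act_fix p t : all (fun i => t <= i%:R) p -> act (pos_word p) t = t.
Proof. by elim: p t => //= i p IHp t /andP[ti tp]; rewrite /slope ti IHp. Qed.

(** The first letter moves i + 1 to i + 2, and no positive letter moves a point to the left. *)
Lemma act_head i p : act (pos_word (i :: p)) i.+1%:R != i.+1%:R.
Proof.
have : slope i i.+1%:R <= act (pos_word (i :: p)) i.+1%:R by apply: act_ge.
rewrite /slope -[i.+1]addn1 natrD => H; apply/eqP => E; move: H; rewrite E.
by repeat case: ifP; lra.
Qed.

(** The action determines the head [l] of a sorted word: the points k + 1 with k < l are fixed,
    while l + 1 is moved. Equal heads are then cancelled. *)
Lemma pos_word_inj p q : pairwise leq p -> pairwise leq q ->
  act (pos_word p) =1 act (pos_word q) -> p = q.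
Proof.
have small k r l : pairwise leq (l :: r) -> (k < l)%N ->
    act (pos_word (l :: r)) k.+1%:R = k.+1%:R.
  rewrite pairwise_cons => /andP[lr _] kl; apply: act_fix; rewrite /= ler_nat kl /=.
  by apply: sub_all lr => m lm; rewrite ler_nat; apply: leq_trans lm.
elim: p q => [|i p IHp] [|j q] // Sp Sq pq.
- by have := act_head j q; rewrite -pq eqxx.
- by have := act_head i p; rewrite pq eqxx.
have [ij|ji|ij] := ltngtP i j.
- by have := act_head i p; rewrite pq (small i) ?eqxx.
- by have := act_head j q; rewrite -pq (small j) ?eqxx.
rewrite ij in pq *; congr cons; apply: IHp.
- by case/andP: Sp.
- by case/andP: Sq.
- by move=> t; have := pq (slope_inv j t); rewrite /= slope_invK.
Qed.

End Slope.

Lemma sorted_word_inj p q : pairwise leq p -> pairwise leq q ->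
  val_word thompson_rel [seq (i, false) | i <- p] =
  val_word thompson_rel [seq (i, false) | i <- q] -> p = q.
Proof.
by move=> Sp Sq /val_wordP pq; apply: Slope.pos_word_inj => // t; apply: Slope.act_pres_eq.
Qed.

(** * Linear length of sorted products *)

Section Short.
Variables (X : choiceType) (a b : pres_group (@no_rel X)) (c : nat).
Hypotheses (len_a : length_le c a) (len_b : length_le c b).
Local Notation x := (thompson_gen a b).

(** Between consecutive letters x_j and x_k only [a ^+ j.-1 * a ^- k.-1] remains, and along a sorted
    word these exponents telescope. The bordering powers of [a] make this an induction. *)
Lemma length_sorted_aux M i p : i <= M -> path leq i p -> all (leq^~ M) p ->
  length_le (c * (size p + (M.-1 - i.-1))) (a ^+ i.-1 * gen_prod x p * a ^- M.-1).
Proof.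
have la m n : m <= n -> length_le (c * (n - m)) (a ^+ m * a ^- n).
  by move=> mn; rewrite -invgF -expgnFr //; apply/length_leV/length_leX.
elim: p i => [|j p IHp] i iM /=.
  move=> _ _; rewrite gen_prod_nil mulg1 add0n.
  by apply: la; lia.
move=> /andP[ij jp] /andP[jM pM]; rewrite gen_prod_cons /thompson_gen conjgE.
have -> : a ^+ i.-1 * (a ^- j.-1 * ((if j is 0 then a else b) * a ^+ j.-1) *
    gen_prod x p) * a ^- M.-1 =
    (a ^+ i.-1 * a ^- j.-1) * ((if j is 0 then a else b) *
    (a ^+ j.-1 * gen_prod x p * a ^- M.-1)) by rewrite !mulgA.
have lb : length_le c (if j is 0 then a else b) by case: (j).
have lij : length_le (c * (j.-1 - i.-1)) (a ^+ i.-1 * a ^- j.-1) by apply: la; lia.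
by apply: length_leW (length_leM lij (length_leM lb (IHp j jM jp pM))); nia.
Qed.

Lemma length_sorted M p : sorted_below M M p -> length_le (3 * c * M) (gen_prod x p).
Proof.
move=> /and3P[Sp sp pM].
have /length_sorted_aux lp : path leq 0 p.
  by rewrite (path_sortedE leq_trans) (sorted_pairwise leq_trans) Sp andbT; apply/allP.
(* At most 2cM for the bordered product and cM for undoing the border. *)
have := length_leM (lp M (leq0n _) pM) (length_leX M.-1 len_a).
by rewrite expg0 mul1g mulgVK; apply: length_leW; nia.
Qed.

End Short.

(** * Change of presentation *)

Definition F_gen (i : nat) : thompson_F := val_word thompson_rel (gen_word i).

Lemma val_word_rel (X : choiceType) (Q : word X -> Prop) r : Q r -> val_word Q r = 1.
Proof.
move=> Qr; apply/val_wordP; have := pres_relator [::] [::] Qr.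
by rewrite /= cats0.
Qed.

Lemma F_genJ i j : i < j -> F_gen j ^ F_gen i = F_gen j.+1.
Proof.
move=> ij; have := @val_word_rel _ thompson_rel _ (ex_intro _ i (ex_intro _ j (conj ij erefl))).
rewrite val_word_eval eval_cat eval_conj eval_inv !eval_gen.
exact: divg1_eq.
Qed.

Lemma F_genM i j : i < j -> F_gen j * F_gen i = F_gen i * F_gen j.+1.
Proof. by move=> ij; rewrite -(F_genJ ij) -conjgC. Qed.

Lemma F_genE i : F_gen i = thompson_gen (F_gen 0) (F_gen 1) i.
Proof.
elim: i => [|[|i] IHi]; first by rewrite thompson_gen0.
  by rewrite /thompson_gen expg0 conjg1.
by rewrite -(@F_genJ 0) // IHi -[i.+2]addn1 thompson_gen_shift expg1.
Qed.

Lemma uniform_bound (T : finType) (Q : T -> nat -> Prop) :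
  (forall t, exists k, Q t k) -> (forall t m n, m <= n -> Q t m -> Q t n) ->
  exists k, forall t, Q t k.
Proof.
move=> Qex QW; suff [k Qk] : exists k, forall t, t \in enum T -> Q t k.
  by exists k => t; apply: Qk; rewrite mem_enum.
elim: (enum T) => [|t s [k Qk]]; first by exists 0%N.
have [l Ql] := Qex t; exists (maxn k l) => u; rewrite inE => /predU1P[->|us].
  by apply: QW Ql; apply: leq_maxr.
by apply: QW (Qk u us); apply: leq_maxl.
Qed.

Section Transfer.
Variables (X : finType) (R : seq (word X)).
Variables (f : thompson_F -> pres_group (fin_rel R)) (g : pres_group (fin_rel R) -> thompson_F).
Hypotheses (fM : {morph f : u v / u * v}) (fK : cancel f g) (gK : cancel g f).

Notation free := (pres_group (@no_rel X)).
Notation pi := (val_word (@no_rel X)).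

Lemma to_pres_surj h : exists k : free, to_pres R k = h.
Proof. by exists (pi (generic_quotient.repr h)); rewrite to_presE val_word_repr. Qed.

(** The letters of [v] are translated into the x_i at bounded radius and the result is combed to
    [P p * (P q)^-1]. Triviality in F forces [p = q], so this normal form is trivial already in the
    free group. *)
Lemma linear_null : exists C, forall v : word X,
  val_word (fin_rel R) v = 1 -> null R (C * (size v).+1) (pi v).
Proof.
have [a aE] := to_pres_surj (f (F_gen 0)); have [b bE] := to_pres_surj (f (F_gen 1)).
pose x := thompson_gen a b.
have xE i : to_pres R (x i) = f (F_gen i).
  rewrite (thompson_gen_morph _ _ _ (@to_presM _ _)) aE bE (F_genE i).
  exact/esym/thompson_gen_morph.
have evE w : to_pres R (eval x w) = f (val_word thompson_rel w).
  rewrite val_word_eval !eval_morph //; last exact: to_presM.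
  exact: eq_eval xE.
have [c1 la] := length_le_ex a; have [c2 lb] := length_le_ex b.
have rel i j : i < j -> exists k, near_eq R k (x j * x i) (x i * x j.+1).
  move=> ij; apply: to_pres_near_eq.
  by rewrite (to_presM _ (x j)) (to_presM _ (x i)) !xE -!fM F_genM.
have [c3 r2] := rel 1%N 2 isT; have [c4 r3] := rel 1%N 3 isT.
have [c [{}la {}lb {}r2 {}r3]] : exists c, [/\ length_le c a, length_le c b,
    near_eq R c (x 2 * x 1%N) (x 1%N * x 3) & near_eq R c (x 3 * x 1%N) (x 1%N * x 4)].
  exists (c1 + c2 + c3 + c4)%N; split.
  - by apply: length_leW la; lia.
  - by apply: length_leW lb; lia.
  - by apply: near_eqW r2; lia.
  - by apply: near_eqW r3; lia.
pose s (e : letter X) : word nat :=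
  let u := generic_quotient.repr (g (val_word (fin_rel R) (gen_word e.1))) in
  if e.2 then inv_word u else u.
have sE e : to_pres R (eval x (s e)) = to_pres R (pi [:: e]).
  rewrite evE to_presE; case: e => y [] /=.
    by rewrite /s /= val_wordV val_word_repr (morph_inv fM) gK -val_wordV.
  by rewrite /s /= val_word_repr gK.
pose Q e k := [/\ near_eq R k (pi [:: e]) (eval x (s e)), size (s e) <= k &
  all (fun d => d.1 <= k) (s e)].
have [||K KQ] := @uniform_bound _ Q.
- move=> e; have [k ek] := to_pres_near_eq (esym (sE e)).
  exists (k + size (s e) + \max_(d <- s e) d.1)%N; split.
  + by apply: near_eqW ek; lia.
  + by lia.
  + apply/allP => d ds; apply: leq_trans (leq_addl _ _).
    exact: (@leq_bigmax_seq _ _ predT (fun d : letter nat => d.1) d ds isT).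
- move=> e m n mn [em sm lm]; split.
  + exact: near_eqW em.
  + exact: leq_trans mn.
  + by apply: sub_all lm => d dm; apply: leq_trans mn.
pose S v := flatten (map s v).
have vE v : near_eq R (size v + K) (pi v) (eval x (S v)).
  elim: v => [|e v IHv]; first by rewrite /eval big_nil; apply: near_eq_refl.
  rewrite /S /= eval_cat -/(S v) -cat1s val_wordM; have [eK _ _] := KQ e.
  apply: near_eq_trans (near_eqMr _ (near_eqW (leq_addl _ _) eK)).
  by rewrite /= -add1n -addnA; apply: near_eqMl IHv; exists [:: e].
have Ssize v : size (S v) <= K * size v.
  elim: v => //= e v IHv; rewrite /S /= size_cat mulnS leq_add //.
  by have [] := KQ e.
have Sall v : all (fun d => d.1 <= K) (S v).
  by elim: v => //= e v IHv; rewrite /S /= all_cat -/(S v) IHv andbT; have [] := KQ e.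
(* The summands pay for the translation radius n + K, for 5L = 50c(M + 1) with M + 1 <= (2K + 1)(n +
   1), and for the uncombed prefix. *)
exists (K.+1 + 50 * c * K.*2.+1 + K * (c * K.*2.+1))%N => v v1.
(* The translated word has indices at most [K] and at most [K * n] letters, and combing raises an
   index by at most one per letter. *)
pose n := size v; pose M := (K + K * n)%N; pose L := (10 * c * M.+1)%N.
have len_prod p : sorted_below M M p -> length_le L (gen_prod x p).
  by move=> np; apply: length_leW (length_sorted la lb np); rewrite /L; nia.
have len_gen i : i <= M -> length_le L (x i).
  by move=> iM; apply: length_leW (length_gen la lb i); rewrite /L; nia.
have rels i j : i < j -> j <= M -> near_eq R L (x j * x i) (x i * x j.+1).
  by move=> ij jM; apply: near_eqW (near_eq_gen la lb r2 r3 ij); rewrite /L; nia.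
have len_K i : i <= K -> length_le (c * K.*2.+1) (x i).
  by move=> iK; apply: length_leW (length_gen la lb i); nia.
have wM : K + size (S v) <= M by rewrite leq_add2l.
have [p [q [np nq e]]] := comb len_prod len_gen rels len_K (Sall v) wM.
have eval_pos r : gen_prod x r = eval x [seq (i, false) | i <- r].
  by rewrite /eval big_map.
have pq : p = q.
  have /and3P[Sp _ _] := np; have /and3P[Sq _ _] := nq.
  apply: sorted_word_inj => //; apply: (can_inj fK).
  rewrite -!evE -!eval_pos; apply: divg1_eq.
  rewrite -(morph_inv (@to_presM _ _)) -to_presM -(near_eq_to_pres e).
  by rewrite -(near_eq_to_pres (vE v)) to_presE.
rewrite pq mulgV in e.
have := near_eq_trans (near_eqW _ (vE v)) (near_eqW _ e).
rewrite /near_eq invg1 mulg1; apply.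
  by rewrite -/n; nia.
have Sn : size (S v) * (c * K.*2.+1) <= K * n * (c * K.*2.+1).
  by rewrite leq_mul2r Ssize orbT.
apply: leq_trans (leq_add (leqnn _) Sn) _; rewrite -/n /L /M; nia.
Qed.

End Transfer.

(** * The presentation of F with two generators and two relators *)

Section FinitePresentation.

Let X := bool : finType.

(** Here [false] stands for x_0 and [true] for x_1. The word represents x_k for positive [k]
    only. *)
Definition F_word (k : nat) : word X :=
  conj_word (gen_word true) (nseq k.-1 (false, false)).

Definition F_relators : seq (word X) :=
  [seq conj_word (F_word k) (F_word 1) ++ inv_word (F_word k.+1) | k <- [:: 2; 3]].

Lemma eval_F_word (H : groupType) (phi : X -> H) k :
  eval phi (F_word k.+1) = thompson_gen (phi false) (phi true) k.+1.
Proof.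
rewrite /F_word eval_conj eval_gen /thompson_gen; congr (_ ^ _).
rewrite /=; elim: k => [|k IHk]; first by rewrite /eval big_nil.
by rewrite /= expgS -cat1s eval_cat IHk /eval big_seq1.
Qed.

Lemma eval_F_relator (H : groupType) (phi : X -> H) k :
  let x := thompson_gen (phi false) (phi true) in
  eval phi (conj_word (F_word k.+1) (F_word 1) ++ inv_word (F_word k.+2)) =
  x k.+1 ^ x 1%N * (x k.+2)^-1.
Proof. by rewrite eval_cat eval_conj eval_inv !eval_F_word. Qed.

Notation F_fin := (pres_group (fin_rel F_relators)).

Let gen (y : X) : F_fin := val_word (fin_rel F_relators) (gen_word y).
Let y := thompson_gen (gen false) (gen true).

(** The derivation of the linear fillings, with the radii forgotten, shows that the two relators
    imply all relations of F. *)
Lemma F_fin_gen i j : i < j -> y j ^ y i = y j.+1.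
Proof.
move=> ij.
pose a := val_word (@no_rel X) (gen_word false); pose b := val_word (@no_rel X) (gen_word true).
have xE k : to_pres F_relators (thompson_gen a b k) = y k.
  by rewrite (thompson_gen_morph _ _ _ (@to_presM _ _)) !to_presE.
have rel k : k \in [:: 2; 3] -> y k * y 1%N = y 1%N * y k.+1.
  move=> k23; have : val_word (fin_rel F_relators)
      (conj_word (F_word k) (F_word 1) ++ inv_word (F_word k.+1)) = 1.
    by apply: val_word_rel; apply/mapP; exists k.
  case: k k23 => // k _; rewrite val_word_eval eval_F_relator.
  move/divg1_eq => yk; have {yk} <- : y k.+1 ^ y 1%N = y k.+2 := yk.
  exact: conjgC.
have near k : k \in [:: 2; 3] -> exists c, near_eq F_relators c
    (thompson_gen a b k * thompson_gen a b 1)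
    (thompson_gen a b 1 * thompson_gen a b k.+1).
  by move=> k23; apply: to_pres_near_eq; rewrite !(to_presM _ (thompson_gen a b _)) !xE rel.
have [//|c2 r2] := near 2; have [//|c3 r3] := near 3.
have la : length_le (1 + c2 + c3) a by exists (gen_word false).
have lb : length_le (1 + c2 + c3) b by exists (gen_word true).
have := near_eq_gen la lb (near_eqW _ r2) (near_eqW _ r3) ij.
rewrite leq_addl addnAC leq_addl => /(_ isT isT) /near_eq_to_pres.
rewrite !(to_presM _ (thompson_gen a b _)) !xE => yE.
by rewrite conjgE yE mulKg.
Qed.

Let F_gen_word (e : X) : thompson_F := F_gen e.

Let y_rel r : thompson_rel r -> eval y r = 1.
Proof.
move=> [i [j [ij ->]]]; rewrite eval_cat eval_conj eval_inv !eval_gen.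
by rewrite F_fin_gen // mulgV.
Qed.

Let F_gen_rel r : fin_rel F_relators r -> eval F_gen_word r = 1.
Proof.
case/mapP=> -[|k] // k23 ->; rewrite eval_F_relator.
by rewrite /F_gen_word /= -!F_genE F_genJ ?mulgV //; case: k k23.
Qed.

Definition F_to_fin : thompson_F -> F_fin := @von_dyck _ thompson_rel _ y.

HB.instance Definition _ := isMultiplicative.Build thompson_F F_fin
  F_to_fin (von_dyckM y_rel).

Lemma F_to_fin_bij : bijective F_to_fin.
Proof.
have gM := von_dyckM F_gen_rel; have fM := von_dyckM y_rel.
exists (von_dyck F_gen_word) => g; rewrite /F_to_fin -(val_word_repr g) val_word_eval.
  rewrite (eval_morph _ _ fM) (eval_morph _ _ gM); apply: eq_eval => i /=.
  rewrite von_dyckE // eval_gen (thompson_gen_morph _ _ _ gM) !von_dyckE // !eval_gen.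
  exact/esym/F_genE.
rewrite (eval_morph _ _ gM) (eval_morph _ _ fM); apply: eq_eval => e /=.
rewrite von_dyckE // eval_gen von_dyckE // eval_gen /y.
by case: e; rewrite ?thompson_gen0 // /thompson_gen expg0 conjg1.
Qed.

Lemma F_finitely_presented : finitely_presented thompson_F.
Proof. by exists X, F_relators, F_to_fin; apply: F_to_fin_bij. Qed.

End FinitePresentation.

(** * The isodiametric function *)

Lemma linear_isodiametric_bound (X : finType) (R : seq (word X)) :
  finite_presentation_of thompson_F R ->
  exists C, isodiametric_bound R (fun n => C * n)%N.
Proof.
move=> [f [g fK gK]]; have [C nullC] := linear_null (@gmulfM _ _ f) fK gK.
pose m := \max_(r <- R) size r.
(* For positive [n] this multiple of [n] bounds twice the radius [C * n.+1 + m + n]; the empty word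
   has a diagram of diameter 0. *)
exists (C.*2 + m).*2.+2 => n w wn w1.
have [->|w0] := eqVneq w [::].
  have [|//||D D0] := @bounded_diagram X R [::] [::] 0.
  - by [].
  - exact: pres_refl.
  - by exists D; apply: leq_trans D0 _.
have n0 : 0 < n by apply: leq_trans wn; rewrite lt0n size_eq0.
have [L [LR LE]] := null_product (nullC w w1).
have [|||D Dk] := @bounded_diagram X R w L (C * n.+1 + m + n).
- by apply: leq_trans wn _; apply: leq_addl.
- move=> b /LR[bk bR]; split=> //; rewrite size_cat.
  have bm : size b.2 <= m.
    case: bR => bR; first exact: (@leq_bigmax_seq _ _ predT size _ bR isT).
    rewrite -[b.2]inv_wordK size_rev size_map.
    exact: (@leq_bigmax_seq _ _ predT size _ bR isT).
  apply: leq_trans (leq_addr _ _); apply: leq_add bm.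
  by apply: leq_trans bk _; rewrite leq_mul2l ltnS wn orbT.
- by apply/val_wordP; rewrite val_wordM val_wordV LE mulVg.
exists D; apply: leq_trans Dk _.
nia.
Qed.

Lemma isodiametric_function_ex (X : finType) (R : seq (word X)) d :
  isodiametric_bound R d -> exists e, isodiametric_function R e.
Proof.
move=> dR; pose ok n k := `[< forall w : word X, size w <= n ->
  val_word (fin_rel R) w = 1 -> exists D : diagram R w, diameter D <= k >].
have okP n : exists k, ok n k by exists (d n); apply/asboolP => w; apply: dR.
exists (fun n => ex_minn (okP n)); split.
  by move=> n w wn w1; case: ex_minnP => k /asboolP kP _; apply: kP.
move=> d' d'R n; case: ex_minnP => k _; apply.
by apply/asboolP => w; apply: d'R.
Qed.

Theorem corollary1 :
  finitely_presented thompson_F /\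
  forall (X : finType) (R : seq (word X)),
    finite_presentation_of thompson_F R ->
    exists d : nat -> nat, isodiametric_function R d /\ linear d.
Proof.
split=> [|X R RF]; first exact: F_finitely_presented.
have [C CR] := linear_isodiametric_bound RF.
have [d [dR dmin]] := isodiametric_function_ex CR.
exists d; split; first by split.
(* The lower bound is automatic, by the additive linear term in [preceq]. *)
split; last by exists 1%N; split=> // n; rewrite !mul1n leq_addl.
exists C.+1; split=> // n; apply: leq_trans (dmin _ CR n) _.
nia.
Qed.
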